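(* Let $\underline{\lambda}=(\lambda_1^{\rho_1}>\lambda_2^{\rho_2}>\cdots>\lambda_k^{\rho_k})$ be a partition and set $\lambda_{k+1}=0$. Let $p\neq 3$ be an odd prime, let $\mathcal{A}_{\underline{\lambda}}=\bigoplus_{i=1}^k(\mathbb{Z}/p^{\lambda_i}\mathbb{Z})^{\rho_i}$ and let $\mathcal{G}_{\underline{\lambda}}=\operatorname{Aut}(\mathcal{A}_{\underline{\lambda}})$. Then, for each $i\in\{1,2\}$, the cohomology group $H^i(\mathcal{G}_{\underline{\lambda}},\mathbb{Z}/p\mathbb{Z})$ (trivial action on $\mathbb{Z}/p\mathbb{Z}$) vanishes if and only if $\lambda_j-\lambda_{j+1}\leq 1$ for all $1\leq j\leq k$.
   Context: A partition $\underline{\lambda}=(\lambda_1^{\rho_1}>\cdots>\lambda_k^{\rho_k})$ consists of positive integers $\lambda_1>\lambda_2>\cdots>\lambda_k$ (the distinct parts) with positive integer multiplicities $\rho_1,\dots,\rho_k$, $k\geq 1$. $H^i$ denotes ordinary group cohomology. *)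

(* Defs.v *)
From HB Require Import structures.
From mathcomp Require Import all_boot all_order all_algebra all_fingroup all_solvable.
From mathcomp Require Import zify.

Set Implicit Arguments.
Unset Strict Implicit.
Unset Printing Implicit Defensive.

Import GRing.Theory.
Local Open Scope ring_scope.

Section Cohomology.

Variables (gT : finGroupType) (G : {group gT}) (R : finNzRingType).

(* Inhomogeneous n-cochains: all functions G^n -> R, where G acts trivially on
   the additive group of R.  The group law is pointwise addition, so cochain n
   carries the same law additively and multiplicatively (see cochainM). *)
Definition cochain n := {ffun {ffun 'I_n -> [subg G]} -> R}.

HB.instance Definition _ n := GRing.Zmodule.on (cochain n).
HB.instance Definition _ n := FinGroup.copy (cochain n)
  {dffun forall g : {ffun 'I_n -> [subg G]}, (R : finGroupType)}.

Lemma cochainM n (f1 f2 : cochain n) : (f1 * f2)%g = f1 + f2.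
Proof. by apply/ffunP => g; rewrite !ffunE. Qed.

Lemma cochain1 n : 1%g = 0 :> cochain n.
Proof. by apply/ffunP => g; rewrite !ffunE. Qed.

(* With g = (g_1, ..., g_{n+1}):
     face 0 g     = (g_2, ..., g_{n+1}),
     face i g     = (g_1, ..., g_i g_{i+1}, ..., g_{n+1})  for 1 <= i <= n,
     face n.+1 g  = (g_1, ..., g_n).
   Here g_{j+1} is the value of g at the ordinal j. *)
Definition face n (i : nat) (g : {ffun 'I_n.+1 -> [subg G]}) :
    {ffun 'I_n -> [subg G]} :=
  [ffun j : 'I_n =>
     let gj := g (widen_ord (leqnSn n) j) in
     let gj1 := g (lift ord0 j) in
     if (j.+1 < i)%N then gj
     else if j.+1 == i then (gj * gj1)%g
     else gj1].

Definition coboundary n (f : cochain n) : cochain n.+1 :=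
  [ffun g => \sum_(i < n.+2) (-1) ^+ i * f (face i g)].

Lemma coboundaryM n :
  {in [set: cochain n] &, {morph @coboundary n : f1 f2 / (f1 * f2)%g}}.
Proof.
move=> f1 f2 _ _; rewrite !cochainM; apply/ffunP => g; rewrite !ffunE.
by rewrite -big_split; apply: eq_bigr => i _; rewrite ffunE mulrDr.
Qed.

Canonical coboundary_morphism n := Morphism (@coboundaryM n).

Definition cocycles n : {group cochain n} := 'ker (@coboundary n).

Definition coboundaries n : {group cochain n} :=
  if n is n'.+1 return {group cochain n}
  then (@coboundary n' @* [set: cochain n'])%G else 1%G.

Lemma face_face n (i j : nat) (g : {ffun 'I_n.+2 -> [subg G]}) :
  (i <= j)%N -> face i (face j.+1 g) = face j (face i g).
Proof.
move=> le_ij; apply/ffunP => l; rewrite !ffunE /=.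
have e : lift ord0 (widen_ord (leqnSn n) l) = widen_ord (leqnSn n.+1) (lift ord0 l).
  exact: val_inj.
rewrite !/bump !leq0n !add1n e.
do !case: ifP => ?; rewrite ?mulgA //; try (exfalso; lia).
Qed.

Lemma coboundaryK n (f : cochain n) : coboundary (coboundary f) = 0.
Proof.
apply/ffunP => g; rewrite !ffunE.
pose F (i j : nat) := (-1) ^+ (i + j) * f (face j (face i g)).
transitivity (\sum_(x : 'I_n.+3 * 'I_n.+2) F x.1 x.2).
  rewrite -(pair_bigA _ (fun (i : 'I_n.+3) (j : 'I_n.+2) => F i j)) /=.
  apply: eq_bigr => i _; rewrite ffunE mulr_sumr; apply: eq_bigr => j _.
  by rewrite mulrA -exprD.
rewrite (bigID (fun x : 'I_n.+3 * 'I_n.+2 => x.2 < x.1)%N) /=.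
pose h (x : 'I_n.+3 * 'I_n.+2) : 'I_n.+3 * 'I_n.+2 := (lift ord0 x.2, inord x.1).
pose h' (x : 'I_n.+3 * 'I_n.+2) : 'I_n.+3 * 'I_n.+2 :=
  (widen_ord (leqnSn _) x.2, inord x.1.-1).
rewrite (reindex_onto h h') /=; last first.
  case=> i j /= lt_ji; have lt_in := ltn_ord i.
  congr pair; apply: val_inj; rewrite /= ?inordK /bump; lia.
rewrite -[X in _ + X]opprK; apply/eqP; rewrite subr_eq0; apply/eqP.
rewrite -sumrN; apply: eq_big => -[i j] /=.
  rewrite -leqNgt; apply/andP/idP => [[lt_ij /eqP [] e1 _]|le_ij].
    have lt_in : (i < n.+2)%N by rewrite -e1 /= ltn_ord.
    move: lt_ij; rewrite inordK // /bump; lia.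
  have lt_jn := ltn_ord j.
  split; first by rewrite inordK /bump; lia.
  by rewrite -pair_eqE /=; apply/andP; split; apply/eqP/val_inj;
    rewrite /= inordK /bump; lia.
case/andP => lt_ij /eqP [] e1 _.
have lt_in : (i < n.+2)%N by rewrite -e1 /= ltn_ord.
have le_ij : (i <= j)%N by move: lt_ij; rewrite inordK // /bump; lia.
rewrite /F /h /= inordK //.
by rewrite /bump leq0n add1n face_face // addSn exprS mulN1r mulNr addnC.
Qed.

Lemma coboundaries_sub n : coboundaries n \subset cocycles n.
Proof.
case: n => [|n]; first exact: sub1G.
apply/subsetP => _ /morphimP [f _ _ ->] /=.
by apply/kerP; rewrite ?inE //= coboundaryK cochain1.
Qed.

(* H^n(G, R). *)
Definition cohomology n : {group coset_of (coboundaries n)} :=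
  (cocycles n / coboundaries n)%G.

End Cohomology.

(* The direct sum of the groups (Z/p^lambda_i)^rho_i; for p prime and
   lambda_i > 0 the modulus exceeds 1, so 'Z_(p ^ lambda_i) is Z/p^lambda_i. *)
Definition abelian_of (p k : nat) (lam rho : k.-tuple nat) : finGroupType :=
  {dffun forall i : 'I_k,
    {dffun 'I_(tnth rho i) -> ('Z_(p ^ tnth lam i) : finGroupType)}}.

(* Main.v *)
Require Import Defs.
From HB Require Import structures.
From mathcomp Require Import all_boot all_order all_algebra all_fingroup all_solvable.
From mathcomp Require Import mxabelem.
From mathcomp Require Import zify ring.

(* Call a finite group low-acyclic if its H^1 and H^2 with coefficients Z/p
   vanish: it has no normal subgroup of index p, and all its central extensions
   by Z/p split.  A group is low-acyclic if a subgroup of index prime to p is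
   (Gaschuetz), or if the kernel and the image of some homomorphism are.

   If A has no gaps then pA has none either, A[p] is not contained in pA, and
   restriction maps Aut(A) onto Aut(pA) with kernel N(A, pA, A[p]), where
   N(A, C, D) is the group of automorphisms a with a = 1 on C and
   (a - 1)A <= D.  So it is enough that N(A, C, D) is low-acyclic when A/C and D
   have exponent p and D is not contained in C.  A Sylow p-subgroup stabilizes a
   subgroup D1 >= D :&: C of index p in D; restricting its stabilizer to C D1
   has kernel N(A, C D1, D) and image N(C D1, C, D1), which reduces the claim to
   the case |D : D :&: C| = p.  There, up to index prime to p, N is a group
   generated by X and Y with [X, Y] = X (x) Y central, and it contains an
   element s acting on X, Y and [X, Y] by the exponents 2, 1/2 and 1.  In a
   central extension by Z/p each x in X has a unique lift t with t^s = t^2; a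
   commutator z of two such lifts satisfies z = z^4, so they commute as p is not
   3.  Since [X, Y] is no smaller than X (x) Y, the lifts of X and Y then
   generate a complement of Z/p.

   If lambda_j - lambda_(j+1) >= 2, the determinant modulo p^2 of the rows and
   columns with exponent at least lambda_j is a homomorphism onto (Z/p^2)^*, so
   H^1 is not zero.  Finally H^2 = 0 forces H^1 = 0: the obstruction to lifting
   a homomorphism from Z/p^m to Z/p^(m+1) lies in H^2, and a finite group has no
   homomorphisms onto Z/p^m for all m. *)


Set Implicit Arguments.
Unset Strict Implicit.
Unset Printing Implicit Defensive.

Import GRing.Theory.

(** * Splitting of central extensions by Z/p *)

Section LowAcyclic.

Local Open Scope group_scope.

Variable p : nat.
Hypothesis p_pr : prime p.

(* H^1(G, Z/p) = H^2(G, Z/p) = 0, in terms of subgroups and extensions. *)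
Definition low_acyclic (rT : finGroupType) (G : {group rT}) : Prop :=
  (forall H : {group rT}, H <| G -> #|G : H| != p) /\
  (forall (gT : finGroupType) (E : {group gT}) (f : {morphism E >-> rT}),
     f @* E = G -> 'ker f \subset 'Z(E) -> #|'ker f| = p ->
     [splits E, over 'ker f]).

Lemma low_acyclic_splits (rT : finGroupType) (G : {group rT}) :
  low_acyclic G ->
  forall (gT : finGroupType) (E D : {group gT}) (f : {morphism D >-> rT}),
  E \subset D -> f @* E = G -> 'ker_E f \subset 'C(E) -> #|'ker_E f| = p ->
  exists2 K : {group gT}, K :&: 'ker_E f = 1 & 'ker_E f * K = E.
Proof.
move=> [_ splG] gT E D f sED fE cE oE.
have kE : 'ker (restrm_morphism sED f) = 'ker_E f by rewrite ker_restrm.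
have /splitsP[K /complP[tiK defE]] : [splits E, over 'ker (restrm_morphism sED f)].
  apply: splG; rewrite ?kE //; first by rewrite im_restrm.
  by rewrite subsetI subsetIl.
by exists K; rewrite -?kE // setIC.
Qed.

Lemma low_acyclic1 (rT : finGroupType) : low_acyclic [1 rT]%G.
Proof.
split=> [H /normal_sub sH1|gT E f fE _ _].
  by rewrite (trivgP sH1) indexgg neq_ltn prime_gt1.
apply/splitsP; exists 1%G; apply/complP; split; first exact/trivgP/subsetIr.
rewrite mulg1; apply/eqP; rewrite eqEsubset subsetIl /= kerE /=.
by rewrite -sub_morphim_pre // fE.
Qed.

(** The index of H :&: N in H equals |NH : N|, a divisor of p; as it is not p, it is 1. *)
Lemma sub_normal_prime_index (gT : finGroupType) (G H N : {group gT}) :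
  (forall K : {group gT}, K <| H -> #|H : K| != p) ->
  N <| G -> #|G : N| = p -> H \subset G -> H \subset N.
Proof.
move=> noH nNG iN sHG.
have nNH : N :&: H <| H by rewrite setIC (normalGI sHG).
have dv : #|H : N| %| p.
  rewrite -iN -indexMg -norm_joinEr; last first.
    by rewrite (subset_trans sHG) ?normal_norm.
  have sJ : N <*> H \subset G by rewrite join_subG normal_sub.
  by rewrite -(Lagrange_index sJ (joing_subl N H)) dvdn_mull.
have := noH _ nNH; rewrite /= setIC indexgI -indexg_eq1.
have [// | i1] := eqVneq #|H : N| 1%N.
by rewrite (prime_nt_dvdP p_pr i1 dv) eqxx.
Qed.

(** A normal subgroup of index p would contain H, making p divide [#|G : H|]. By Gaschuetz a central
    extension splits as soon as its restriction to the preimage of H does. *)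
Lemma low_acyclic_coprime_index (rT : finGroupType) (G H : {group rT}) :
  H \subset G -> coprime p #|G : H| -> low_acyclic H -> low_acyclic G.
Proof.
move=> sHG coH aH; split=> [N nNG|gT E f fE cE oE].
  apply/negP=> /eqP iN.
  have sHN := sub_normal_prime_index (proj1 aH) nNG iN sHG.
  move: coH; rewrite prime_coprime // => /negP[].
  by rewrite -{1}iN indexgS.
have sHE : f @*^-1 H \subset E by apply: subsetIl.
have sKH : 'ker f \subset f @*^-1 H by rewrite morphpreS ?sub1G.
have nKE : 'ker f <| E by apply: ker_normal.
have cKE : 'ker f \subset 'C(E) by rewrite (subset_trans cE) ?subsetIr.
have abK : abelian ('ker f) by apply: subset_trans cKE (centS (subsetIl _ _)).
rewrite (Gaschutz_split nKE sKH sHE abK); last first.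
  by rewrite oE -{1}(_ : f @*^-1 G = E) ?index_morphpre ?fE // -fE morphimGK ?subsetIl.
have kE : 'ker_(f @*^-1 H) f = 'ker f by apply/setIidPr.
have [||||K tiK defE] := low_acyclic_splits aH (f := f) (E := (f @*^-1 H)%G).
- by [].
- by rewrite /= morphpreK // fE.
- by rewrite kE (subset_trans cKE) ?centS.
- by rewrite kE.
move: tiK defE; rewrite kE => tiK defE.
by apply/splitsP; exists K; apply/complP; split; rewrite 1?setIC.
Qed.

(** Over the kernel of f the extension is Z times some M. Once M is normal in E, the quotient E / M
    is a central extension of [f @* G] by a group of order p, and the preimage K of a complement
    there is a complement of Z. *)
Lemma low_acyclic_extension (rT sT : finGroupType) (D G : {group rT})
    (f : {morphism D >-> sT}) :
  G \subset D -> low_acyclic ('ker_G f)%G -> low_acyclic (f @* G)%G ->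
  low_acyclic G.
Proof.
move=> sGD aN aQ; split=> [H nHG|gT E h hE cE oE].
  apply/negP=> /eqP iH.
  have sNH := sub_normal_prime_index (proj1 aN) nHG iH (subsetIl _ _).
  have := index_morphim_ker f (normal_sub nHG) sGD.
  rewrite (eqP (_ : #|_ : H| == 1%N)) ?indexg_eq1 // muln1 iH.
  by apply/eqP/(proj1 aQ); rewrite morphim_normal.
set Z := 'ker h in cE oE *.
have cZE : Z \subset 'C(E) by rewrite (subset_trans cE) ?subsetIr.
pose N1 := (h @*^-1 ('ker_G f))%G.
have sN1E : N1 \subset E by apply: subsetIl.
have sZN1 : Z \subset N1 by rewrite morphpreS ?sub1G.
have nN1 : N1 <| E.
  rewrite -(_ : h @*^-1 G = E) ?morphpre_normal ?hE ?subsetIl //.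
    exact: normalGI sGD (ker_normal f).
  by rewrite -hE morphimGK ?subsetIl.
have kN1 : 'ker_N1 h = Z by apply/setIidPr.
have hN1 : h @* N1 = 'ker_G f by rewrite morphpreK // hE subsetIl.
have [||||M tiM defN1] := low_acyclic_splits aN (f := h) (E := N1) => //.
- by rewrite kN1 (subset_trans cZE) ?centS.
- by rewrite kN1.
rewrite kN1 in tiM defN1.
have sMN1 : M \subset N1 by rewrite -defN1 mulG_subr.
have sME := subset_trans sMN1 sN1E.
have kM : 'ker_M h = 1 by [].
have hM : h @* M = 'ker_G f.
  rewrite -hN1 -defN1 morphimMl ?subsetIl // morphim_ker mul1g //.
have iM : #|N1 : M| = p.
  by rewrite -divgS // -[in #|N1|]defN1 TI_cardMg 1?setIC // mulnK // oE.
have cZ := subsetP cZE.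
have nMN1 : N1 \subset 'N(M).
  by rewrite -defN1 mul_subG ?normG // cents_norm // (subset_trans cZE) ?centS.
(* A conjugate of M is normal of index p in N1, while M, isomorphic to ['ker_G f], has no normal
   subgroup of index p; hence M lies in that conjugate. *)
have nME : E \subset 'N(M).
  apply/normsP=> g Eg; apply/eqP; rewrite eq_sym eqEcard cardJg leqnn andbT.
  have defNg : N1 :^ g = N1 by rewrite (normsP (normal_norm nN1)).
  have nMgN1 : (M :^ g)%G <| N1 by rewrite -{1}defNg normalJ /normal sMN1.
  have iMg : #|N1 : (M :^ g)%G| = p by rewrite -iM -(indexJg N1 M g) defNg.
  apply: (sub_normal_prime_index _ nMgN1 iMg) => // K nKM.
  have := index_morphim_ker h (normal_sub nKM) sME.
  rewrite kM (eqP (_ : #|1%g : K| == 1%N)) ?indexg_eq1 ?sub1G //.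
  rewrite muln1 => <-; rewrite hM; apply: (proj1 aN (h @* K)%G).
  by rewrite /= -hM morphim_normal.
have sE_fh : E \subset h @*^-1 D.
  by rewrite -sub_morphim_pre // hE.
pose fh := restrm_morphism sE_fh [morphism of f \o h].
have fhE : fh @* E = f @* G.
  by rewrite im_restrm morphim_comp hE.
have kfh : 'ker fh = N1.
  rewrite ker_restrm ker_comp; apply/setP=> x; rewrite !inE.
  by case Ex: (x \in E) => //=; rewrite -hE mem_morphim.
have sK : 'ker (coset M) \subset 'ker fh by rewrite ker_coset kfh.
pose q := [morphism of factm sK nME].
have qE : q @* (E / M) = f @* G by rewrite morphim_factm.
have kq : 'ker q = N1 / M by rewrite ker_factm kfh.
have oq : #|N1 / M| = p by rewrite card_quotient.
have cq : N1 / M \subset 'Z(E / M).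
  by rewrite subsetI quotientS //= -defN1 quotientMidr quotient_cents.
have /splitsP[Kb /complP[]] : [splits E / M, over 'ker q].
  by apply: (proj2 aQ); rewrite ?kq.
rewrite kq => tiKb defEb.
have sKbE : Kb \subset E / M by rewrite -defEb mulG_subr.
have nME' : M <| E by apply/andP.
have [K defKb sMK sKE] := inv_quotientS nME' sKbE.
have tiK : K :&: Z = 1.
  have nMK : K \subset 'N(M) := subset_trans sKE nME.
  apply/trivgP; rewrite -tiM subsetI subsetIr andbT.
  rewrite -quotient_sub1 ?(subset_trans (subsetIl _ _)) //.
  by rewrite -tiKb defKb setIC (subset_trans (quotientI _ _ _)) // setISS ?quotientS.
apply/splitsP; exists K; apply/complP; split; first by rewrite setIC.
apply/eqP; rewrite eqEcard mul_subG ?subsetIl //= TI_cardMg 1?setIC //.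
have <- : (#|E / M| * #|M|)%N = #|E|.
  by rewrite card_quotient // mulnC Lagrange.
rewrite -defEb TI_cardMg // oq defKb oE -mulnA leq_mul2l.
by rewrite card_quotient ?(subset_trans sKE) // mulnC Lagrange ?leqnn ?orbT.
Qed.

End LowAcyclic.

(** * Groups of rank one *)

Section RankOne.

Local Open Scope group_scope.

Variable p : nat.
Hypotheses (p_pr : prime p) (p_gt3 : 3 < p).

Lemma expg_coprime1 (gT : finGroupType) (z : gT) m n :
  coprime m n -> z ^+ m = 1 -> z ^+ n = 1 -> z = 1.
Proof.
move=> co zm zn; apply/eqP; rewrite -order_eq1 -dvdn1 -(eqP co) dvdn_gcd.
by rewrite !order_dvdn zm zn eqxx.
Qed.

Lemma expg_eqmod (gT : finGroupType) (x : gT) k m n :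
  x ^+ k = 1 -> m = n %[mod k] -> x ^+ m = x ^+ n.
Proof. by move=> xp e; rewrite -(expg_mod _ xp) e expg_mod. Qed.

(** K consists of the lifts that s doubles. A lift t is corrected by the central element z = t^-2
    t^s, since (t z)^s = t^2 z^2; a doubled element of the kernel is fixed by s, hence trivial. *)
Lemma doubling_lift (gT rT : finGroupType) (E : {group gT})
    (f : {morphism E >-> rT}) (X : {group rT}) (s : gT) :
  'ker f \subset 'C(E) -> #|'ker f| = p -> s \in E -> X \subset f @* E ->
  abelian X -> (forall x, x \in X -> x ^ (f s) = x ^+ 2) ->
  exists K : {group gT}, [/\ K \subset E, f @* K = X, K :&: 'ker f = 1,
    abelian K & forall t, t \in K -> t ^ s = t ^+ 2].
Proof.
set Z := 'ker f => cZE oZ Es sXE abX dbl.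
pose S := [set t in f @*^-1 X | t ^ s == t ^+ 2].
have SP t : t \in S -> [/\ t \in E, f t \in X & t ^ s = t ^+ 2].
  by rewrite !inE => /andP[/andP[? ?] /eqP].
have cZ z t : z \in Z -> t \in E -> commute z t.
  by move=> /(subsetP cZE)/centP cz /cz.
have Zp z : z \in Z -> z ^+ p = 1 by move=> Zz; rewrite -oZ expg_cardG.
have cSS t u : t \in S -> u \in S -> commute t u.
  move=> /SP[Et Xt ts] /SP[Eu Xu us].
  have Zz : [~ t, u] \in Z.
    by apply/kerP; rewrite ?groupR // morphR //; apply/eqP/commgP/(centsP abX).
  (* The commutator is central, so s fixes it, but conjugation by s also raises it to the 4th power;
     its cube is therefore 1, and p > 3. *)
  apply/commgP/eqP.
  apply: (@expg_coprime1 _ _ p 3); last 1 first.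
  - have: [~ t, u] ^ s = [~ t, u] by rewrite conjgE (cZ _ _ Zz Es) mulKg.
    rewrite conjRg ts us commXXg; try by apply: commute_sym; apply: cZ.
    by rewrite (expgS _ 3) => e; apply: (mulgI [~ t, u]); rewrite mulg1.
  - by rewrite prime_coprime // gtnNdvd.
  by rewrite Zp.
have gS : group_set S.
  apply/group_setP; split=> [|t u St Su].
    by rewrite !inE !group1 morph1 group1 conj1g expg1n eqxx.
  have [Et Xt ts] := SP _ St; have [Eu Xu us] := SP _ Su.
  rewrite !inE !groupM //= morphM // groupM //= conjMg ts us expgMn //.
  exact: cSS.
exists (Group gS); split=> [| | | |t /SP[] //].
- by apply/subsetP=> t /SP[].
- apply/eqP; rewrite eqEsubset; apply/andP; split.
    by apply/subsetP=> _ /morphimP[t _ /SP[_ Xt _] ->].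
  apply/subsetP=> x Xx; have /morphimP[t Et _ def_x] := subsetP sXE x Xx.
  pose z := (t ^+ 2)^-1 * t ^ s.
  have Zz : z \in Z.
    apply/kerP; first by rewrite !(groupM, groupV, groupJ, groupX).
    rewrite morphM ?(groupM, groupV, groupJ, groupX) // morphV ?groupX //.
    by rewrite morphX // morphJ // -def_x dbl // mulVg.
  have Ez : z \in E by case/morphpreP: Zz.
  have Szt : t * z \in S.
    rewrite !inE groupM //= morphM // (mker Zz) mulg1 -def_x Xx /= conjMg.
    have -> : z ^ s = z by rewrite conjgE (cZ _ _ Zz Es) mulKg.
    have -> : t ^ s = t ^+ 2 * z by rewrite /z mulKVg.
    by rewrite -mulgA -expgMn //; apply: commute_sym; apply: cZ.
  apply/morphimP; exists (t * z) => //; first by rewrite groupM.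
  by rewrite morphM // (mker Zz) mulg1.
- apply/trivgP/subsetP=> t /setIP[/SP[Et Xt ts] Zt]; apply/set1P.
  by apply: (mulgI t); rewrite mulg1 -expg2 -ts conjgE (cZ _ _ Zt Es) mulKg.
by apply/centsP=> t St u Su; apply: cSS.
Qed.

(** * Bilinear calculus of commutators that centralise both factors *)

Section Commutators.

Variables (gT : finGroupType) (A B : {group gT}).
Hypotheses (cRA : [~: A, B] \subset 'C(A)) (cRB : [~: A, B] \subset 'C(B)).

Lemma central_commg_abelian : abelian [~: A, B].
Proof.
have sR : [~: A, B] \subset A <*> B.
  by rewrite (subset_trans _ (der1_subG (A <*> B))) // commgSS ?joing_subl ?joing_subr.
by rewrite /abelian (subset_trans _ (centS sR)) // centY subsetI cRA cRB.
Qed.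

Lemma central_commgMl t t' u :
  t \in A -> t' \in A -> u \in B -> [~ t * t', u] = [~ t, u] * [~ t', u].
Proof.
move=> At At' Bu; rewrite commMgJ [[~ t, u] ^ t']conjgE.
by rewrite (centP (subsetP cRA _ (mem_commg At Bu)) _ At') mulKg.
Qed.

Lemma central_commgMr t u u' :
  t \in A -> u \in B -> u' \in B -> [~ t, u * u'] = [~ t, u] * [~ t, u'].
Proof.
move=> At Bu Bu'; rewrite commgMJ [[~ t, u] ^ u']conjgE.
rewrite (centP (subsetP cRB _ (mem_commg At Bu)) _ Bu') mulKg.
by apply: (centsP central_commg_abelian); apply: mem_commg.
Qed.

Lemma central_commgX t u n :
  t \in A -> u \in B -> [~ t, u ^+ n] = [~ t ^+ n, u].
Proof.
move=> At Bu; elim: n => [|n IHn]; first by rewrite comm1g commg1.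
by rewrite !expgS central_commgMl ?central_commgMr ?groupX // IHn.
Qed.

(** The list stands for a sum of pure tensors; this is its image in [A, B]. *)
Definition commg_prod (l : seq (gT * gT)) := \prod_(i <- l) [~ i.1, i.2].

Lemma mem_commg_prod l :
  all [pred i | (i.1 \in A) && (i.2 \in B)] l -> commg_prod l \in [~: A, B].
Proof.
rewrite /commg_prod; elim: l => [|i l IHl] /=; first by rewrite big_nil group1.
by case/andP=> /andP[Ai Bi] /IHl Rl; rewrite big_cons groupM ?mem_commg.
Qed.

Lemma commg_prodP z :
  z \in [~: A, B] ->
  exists2 l, all [pred i | (i.1 \in A) && (i.2 \in B)] l & z = commg_prod l.
Proof.
case/gen_prodgP=> n [c Rc ->]; elim: n c Rc => [|n IHn] c Rc.
  by exists [::]; rewrite // /commg_prod big_nil big_ord0.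
have [l Al El] := IHn (c \o lift ord0) (fun i => Rc _).
have /imset2P[t u At Bu Etu] := Rc ord0.
by exists ((t, u) :: l); rewrite /= ?At ?Bu // /commg_prod big_cons big_ord_recl Etu /= El.
Qed.

(** In tensor notation, the sum of (x + c(x) t) (x) y is the sum of x (x) y plus t (x) v, where v is
    the sum of the c(x) y. This elimination step serves to shorten a product of commutators. *)
Lemma commg_prod_shear (l : seq (gT * gT)) (c : gT -> nat) t :
    t \in A -> all [pred i | (i.1 \in A) && (i.2 \in B)] l ->
  (\prod_(i <- l) i.2 ^+ c i.1 \in B) /\
  commg_prod [seq (i.1 * t ^+ c i.1, i.2) | i <- l] =
    commg_prod l * [~ t, \prod_(i <- l) i.2 ^+ c i.1].
Proof.
rewrite /commg_prod => At; elim: l => [|[x y] l IHl] /=.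
  by rewrite !big_nil group1 commg1 mulg1.
case/andP=> /andP[Ax By] /= Al; have [Bl El] := IHl Al.
rewrite !big_cons /= groupM ?groupX //; split=> //.
rewrite El central_commgMl ?groupX // central_commgMr ?groupX //.
rewrite central_commgX //.
have cR : commute [~ t ^+ c x, y] (commg_prod l).
  by apply: (centsP central_commg_abelian); rewrite ?mem_commg ?groupX ?mem_commg_prod.
move: cR; rewrite /commg_prod.
move: [~ x, y] [~ _ ^+ _, y] (\prod_(i <- l) [~ i.1, i.2]) [~ t, _] => a b d e cR.
by rewrite mulgA -(mulgA a b) cR !mulgA.
Qed.

End Commutators.

(** * Groups generated, up to index prime to p, by two abelian subgroups with a doubling element *)

Section RankOneGroup.

Variables (rT : finGroupType) (N X Y W : {group rT}) (s : rT).
Hypotheses (Ns : s \in N) (sXN : X \subset N) (sYN : Y \subset N) (sWN : W \subset N).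
Hypotheses (abX : abelian X) (abY : abelian Y).
Hypothesis dblX : forall x, x \in X -> x ^ s = x ^+ 2.
Hypothesis dblY : forall y, y \in Y -> y ^ s^-1 = y ^+ 2.
Hypotheses (sRW : [~: X, Y] \subset W) (cWX : W \subset 'C(X)).
Hypotheses (cWY : W \subset 'C(Y)) (cWs : W \subset 'C[s]).
Hypothesis indep : forall x y w, x \in X -> y \in Y -> w \in W ->
  x * y * w = 1 -> x = 1 /\ y = 1.
(* Injectivity of X (x) Y -> [X, Y], tested against a functional c with c x = 1. *)
Hypothesis tensor : forall x, x \in X -> x != 1 ->
  exists2 c : rT -> nat, c x = 1%N &
  forall l : seq (rT * rT), all [pred i | (i.1 \in X) && (i.2 \in Y)] l ->
    commg_prod l = 1 -> \prod_(i <- l) i.2 ^+ c i.1 = 1.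
Hypothesis coXY : coprime p #|N : X <*> Y|.

(** H would contain the derived subgroup, and the doubling relations say x = [x, s] on X and y =
    [y, s^-1] on Y; so H would contain X and Y, against [coXY]. *)
Lemma rank_one_no_index (H : {group rT}) : H <| N -> #|N : H| != p.
Proof.
move=> nHN; apply/negP=> /eqP iH; move: coXY; rewrite prime_coprime // => /negP[].
rewrite -{1}iH; apply: indexgS.
have oNH : #|N / H| = p by rewrite card_quotient ?normal_norm.
have sN'H : N^`(1) \subset H.
  apply: der1_min; first exact: normal_norm.
  by apply/cyclic_abelian/prime_cyclic; rewrite oNH.
have mR x y : x \in N -> y \in N -> [~ x, y] \in H.
  by move=> Nx Ny; apply: (subsetP sN'H); apply: mem_commg.
rewrite join_subG; apply/andP; split; apply/subsetP=> x Ax.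
  have Nx := subsetP sXN x Ax.
  by rewrite (_ : x = [~ x, s]) ?mR // commgEl dblX // expg2 mulKg.
have Nx := subsetP sYN x Ax.
by rewrite (_ : x = [~ x, s^-1]) ?mR ?groupV // commgEl dblY // expg2 mulKg.
Qed.

(** The doubled lifts A of X and B of Y generate a group H meeting Z trivially; Gaschuetz passes
    from Z H, whose index is prime to p, to E. *)
Lemma rank_one_splits (gT : finGroupType) (E : {group gT})
    (f : {morphism E >-> rT}) :
  f @* E = N -> 'ker f \subset 'Z(E) -> #|'ker f| = p ->
  [splits E, over 'ker f].
Proof.
move=> fE cE oZ; set Z := 'ker f.
have cZE : Z \subset 'C(E) by rewrite (subset_trans cE) ?subsetIr.
have cZ z t : z \in Z -> t \in E -> commute z t.
  by move=> /(subsetP cZE)/centP cz /cz.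
have /morphimP[h Eh _ fh] : s \in f @* E by rewrite fE.
have [||A [sAE fA tiA abA dblA]] := doubling_lift cZE oZ Eh _ abX.
- by rewrite fE.
- by move=> x; rewrite -fh; apply: dblX.
have [|||B [sBE fB tiB abB dblB]] := @doubling_lift _ _ E f Y h^-1 cZE oZ _ _ abY.
- by rewrite groupV.
- by rewrite fE.
- by move=> x; rewrite morphV // -fh; apply: dblY.
(* If t^w = t z with z in Z, conjugating by g gives t^2 z on one side and (t^2)^w = t^2 z^2 on the
   other, so z = 1. *)
have cent_dbl (C : {group gT}) g w : C \subset E -> g \in E -> w \in E ->
    (forall t, t \in C -> t ^ g = t ^+ 2) -> f w \in 'C(f @* C) ->
    commute (f w) (f g) -> w \in 'C(C).
  move=> sCE Eg Ew dblC cw cg; apply/centP=> t Ct.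
  have Et := subsetP sCE t Ct.
  have [z Zz etw] : exists2 z, z \in Z & t ^ w = t * z.
    exists [~ t, w]; last by rewrite commgEl mulKVg.
    apply/kerP; rewrite ?groupR // morphR //; apply/eqP/commgP/commute_sym.
    exact: (centP cw) (mem_morphim _ _ _).
  have Zz0 : [~ w, g] \in Z.
    by apply/kerP; rewrite ?groupR // morphR //; apply/eqP/commgP.
  have ewg : w ^ g = w * [~ w, g] by rewrite commgEl mulKVg.
  have Zc z' u : z' \in Z -> u \in E -> u ^ z' = u.
    by move=> Zz' Eu; rewrite conjgE -(cZ _ _ Zz' Eu) mulKg.
  have Zc' z' u : z' \in Z -> u \in E -> z' ^ u = z'.
    by move=> Zz' Eu; rewrite conjgE (cZ _ _ Zz' Eu) mulKg.
  have: (t ^ w) ^ g = (t ^ g) ^ (w ^ g) by rewrite -!conjgM -conjgC.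
  rewrite {1}etw conjMg (Zc' _ _ Zz Eg) (dblC t) // ewg conjgM [_ ^ [~ w, g]]Zc //; last first.
    by rewrite groupJ ?groupX.
  rewrite conjXg etw !expg2 -!mulgA => /mulgI e.
  have z1 : z = 1 by apply: (mulIg (t * z)); rewrite mul1g.
  by rewrite /commute [RHS]conjgC etw z1 mulg1.
have fR : f @* [~: A, B] = [~: X, Y] by rewrite morphimR // fA fB.
have sRE : [~: A, B] \subset E.
  by rewrite (subset_trans (commgSS sAE sBE)) // (der1_subG E).
have RW r : r \in [~: A, B] -> f r \in W.
  by move=> Rr; apply: (subsetP sRW); rewrite -fR mem_morphim // (subsetP sRE).
have cRA : [~: A, B] \subset 'C(A).
  apply/subsetP=> r Rr; apply: (cent_dbl A h) => //.
  - exact: (subsetP sRE).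
  - by rewrite fA (subsetP cWX) // RW.
  by rewrite -fh; apply/cent1P; rewrite (subsetP cWs) ?RW.
have cRB : [~: A, B] \subset 'C(B).
  apply/subsetP=> r Rr; apply: (cent_dbl B h^-1) => //.
  - by rewrite groupV.
  - exact: (subsetP sRE).
  - by rewrite fB (subsetP cWY) // RW.
  by rewrite morphV // -fh; apply/commuteV/cent1P; rewrite (subsetP cWs) ?RW.
have fAX t : t \in A -> f t \in X.
  by move=> At; rewrite -fA mem_morphim // (subsetP sAE).
have fBY t : t \in B -> f t \in Y.
  by move=> Bt; rewrite -fB mem_morphim // (subsetP sBE).
have injA t : t \in A -> f t = 1 -> t = 1.
  move=> At ft; apply/set1P; rewrite -[[set 1]]/(1%g : {set gT}) -tiA inE At.
  by apply/kerP; rewrite // (subsetP sAE).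
have injB t : t \in B -> f t = 1 -> t = 1.
  move=> At ft; apply/set1P; rewrite -[[set 1]]/(1%g : {set gT}) -tiB inE At.
  by apply/kerP; rewrite // (subsetP sBE).
pose fl := map (fun i : gT * gT => (f i.1, f i.2)).
have fl_all l : all [pred i | (i.1 \in A) && (i.2 \in B)] l ->
    all [pred i | (i.1 \in X) && (i.2 \in Y)] (fl l).
  by elim: l => //= i l IHl /andP[/andP[Ai Bi] /IHl->]; rewrite fAX // fBY.
have fl_prod l : all [pred i | (i.1 \in A) && (i.2 \in B)] l ->
    f (commg_prod l) = commg_prod (fl l).
  rewrite /commg_prod; elim: l => [|i l IHl] /=; first by rewrite !big_nil morph1.
  case/andP=> /andP[Ai Bi] Al; rewrite !big_cons -IHl //=.
  have [Ei1 Ei2] := (subsetP sAE _ Ai, subsetP sBE _ Bi).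
  by rewrite morphM ?morphR ?groupR //; apply: (subsetP sRE); apply: mem_commg_prod.
(* f is injective on [A, B]: the functional of [tensor] with value 1 at f t gives u v = 1, where v
   collects the weighted right entries of l. Then [t, u] = [t^-1, v] is absorbed by a shear, and the
   list gets shorter. *)
have prod_inj n l : size l <= n -> all [pred i | (i.1 \in A) && (i.2 \in B)] l ->
    f (commg_prod l) = 1 -> commg_prod l = 1.
  elim: n l => [|n IHn] [|[t u] l] //=; rewrite ?ltnS; try by rewrite /commg_prod big_nil.
  move=> sz_l /andP[/andP[/= At Bu] Al] fl1.
  have [t1 | nt_t] := eqVneq (f t) 1.
    move: fl1; rewrite /commg_prod big_cons /= (injA t At t1) comm1g mul1g.
    exact: IHn.
  have [c ct /(_ (fl ((t, u) :: l)))] := tensor (fAX t At) nt_t.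
  have Atl : all [pred i | (i.1 \in A) && (i.2 \in B)] ((t, u) :: l).
    by rewrite /= At Bu.
  rewrite (fl_all _ Atl) -(fl_prod _ Atl) => /(_ isT fl1).
  rewrite big_cons /= ct expg1.
  pose c' x := c (f x).
  have [|Bv Ev] := @commg_prod_shear _ A B cRA cRB l c' t^-1 _ Al; first by rewrite groupV.
  set v := \prod_(i <- l) _ in Bv Ev.
  have -> : \prod_(j <- fl l) j.2 ^+ c j.1 = f v.
    rewrite /v; elim: (l) Al => [|i l' IHl'] /=; first by rewrite !big_nil morph1.
    case/andP=> /andP[Ai Bi] Al'; rewrite !big_cons /=.
    have Ei2 := subsetP sBE _ Bi.
    have [Bv' _] := @commg_prod_shear _ A B cRA cRB l' c' t At Al'.
    by rewrite morphM ?morphX ?groupX ?IHl' // (subsetP sBE).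
  rewrite -morphM ?(subsetP sBE) // => /injB; rewrite groupM // => /(_ isT) uv1.
  have Etu : commg_prod ((t, u) :: l) = commg_prod [seq (i.1 * t^-1 ^+ c' i.1, i.2) | i <- l].
    rewrite Ev {1}/commg_prod big_cons -/(commg_prod l) /=.
    rewrite (_ : [~ t, u] = [~ t^-1, v]); last first.
      apply: (mulIg [~ t, v]); rewrite -(central_commgMl cRA) ?groupV // mulVg comm1g.
      by rewrite -(central_commgMr cRA cRB) // uv1 commg1.
    apply: (centsP (central_commg_abelian cRA cRB)); last exact: mem_commg_prod.
    by rewrite mem_commg ?groupV.
  rewrite Etu; apply: IHn; rewrite ?size_map -?Etu //.
  by rewrite all_map; apply: sub_all Al => i /= /andP[Ai ->]; rewrite groupM ?groupX ?groupV.
pose R := [~: A, B]%G.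
have eBR : B <*> R = B * R by rewrite cent_joinEr.
have nABR : A \subset 'N(B <*> R).
  apply/subsetP=> t At; rewrite inE -genJ gen_subG conjUg subUset; apply/andP; split.
    apply/subsetP=> _ /imsetP[u Bu ->]; rewrite conjg_mulR groupM ?mem_gen ?inE ?Bu //.
    by rewrite -[[~ u, t]]invg_comm !groupV (mem_commg At Bu) orbT.
  apply/subsetP=> _ /imsetP[r Rr ->]; rewrite conjgE (centP (subsetP cRA r Rr)) //.
  by rewrite mulKg mem_gen // inE Rr orbT.
pose H := (A <*> (B <*> R))%G.
have eH : H :=: A * (B * R) by rewrite -eBR -norm_joinEl.
have sHE : H \subset E by rewrite !join_subG sAE sBE.
(* By [indep] the components in A and B of an element of H :&: Z are trivial; injectivity on [A, B]
   kills the remaining one. *)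
have tiH : H :&: Z = 1.
  apply/trivgP/subsetP=> w /setIP[]; rewrite eH => /mulsgP[t _ At /mulsgP[u r Bu Rr ->] ->] Zw.
  have [[Et Eu] Er] := (subsetP sAE t At, subsetP sBE u Bu, subsetP sRE r Rr).
  have Etu : t * u \in E by rewrite groupM.
  have := mker Zw; rewrite mulgA (morphM _ Etu Er) morphM // => f1.
  have [ft fu] := indep (fAX t At) (fBY u Bu) (RW r Rr) f1.
  move: f1; rewrite ft fu !mul1g.
  have -> : t = 1 by apply: injA.
  have -> : u = 1 by apply: injB.
  rewrite !mul1g.
  have [l Al ->] := commg_prodP Rr => f1.
  by rewrite (prod_inj (size l)) ?inE.
have nZE : Z <| E by apply: ker_normal.
have abZ : abelian Z by apply: subset_trans cZE (centS (subsetIl _ _)).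
have sZE : Z \subset E := normal_sub nZE.
have eZH : Z <*> H = Z * H by rewrite cent_joinEr // (subset_trans sHE) // centsC.
have sZHE : Z <*> H \subset E by rewrite join_subG sZE.
rewrite (Gaschutz_split nZE (joing_subl Z H) sZHE abZ); last first.
  rewrite oZ -(index_morphim_ker f sZHE (subxx _)) (setIidPr sZE).
  rewrite (eqP (_ : #|Z : _| == 1%N)) ?indexg_eq1 ?joing_subl // muln1 fE.
  apply: coprime_dvdr coXY; apply: indexgS; rewrite join_subG -fA -fB.
  have sAH : A \subset H by apply: joing_subl.
  have sBH : B \subset H by apply: subset_trans (joing_subl B R) (joing_subr A _).
  by rewrite !morphimS // (subset_trans _ (joing_subr Z H)).
apply/splitsP; exists H; apply/complP; split; last exact: esym eZH.
by rewrite setIC.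
Qed.

Lemma rank_one_low_acyclic : low_acyclic p N.
Proof. by split; [apply: rank_one_no_index | apply: rank_one_splits]. Qed.

End RankOneGroup.

End RankOne.

(** * Automorphisms fixing a subgroup and inducing the identity on a quotient *)

Section RelAut.

Local Open Scope group_scope.

Variable gT : finGroupType.
Implicit Types (A B C D : {group gT}) (a b : {perm gT}).

(* [displacement a] is a - 1 in additive notation. *)
Fact displacement_key : unit. Proof. exact: tt. Qed.
Definition displacement : {perm gT} -> gT -> gT :=
  locked_with displacement_key (fun a x => x^-1 * a x).

Lemma displacementE a x : displacement a x = x^-1 * a x.
Proof. by rewrite /displacement unlock. Qed.

Lemma displacementK a x : x * displacement a x = a x.
Proof. by rewrite displacementE mulKVg. Qed.

(** This is N(A, C, D); for abelian A each member amounts to a homomorphism a - 1 from A / C to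
    D. *)
Definition rel_aut_set A C D :=
  [set a in Aut A | [forall x in C, a x == x] && [forall x in A, displacement a x \in D]].

Lemma rel_autP A C D a :
  reflect [/\ a \in Aut A, {in C, forall x, a x = x}
            & {in A, forall x, displacement a x \in D}]
          (a \in rel_aut_set A C D).
Proof.
apply: (iffP setIdP) => [[Aa /andP[/forall_inP Ca /forall_inP Da]]|[Aa Ca Da]].
  by split=> // x /Ca/eqP.
by split=> //; apply/andP; split; apply/forall_inP=> // x /Ca->.
Qed.

Lemma AutM A a x y : a \in Aut A -> x \in A -> y \in A -> a (x * y) = a x * a y.
Proof. by move=> Aa Ax Ay; rewrite -(autmE Aa) morphM. Qed.

Lemma AutX A a x n : a \in Aut A -> x \in A -> a (x ^+ n) = a x ^+ n.
Proof. by move=> Aa Ax; rewrite -(autmE Aa) morphX. Qed.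

Lemma Aut_1 A a : a \in Aut A -> a 1 = 1.
Proof. by move=> Aa; rewrite -(autmE Aa) morph1. Qed.

Lemma rel_aut_group_set A C D : group_set (rel_aut_set A C D).
Proof.
apply/group_setP; split=> [|a b /rel_autP[Aa Ca Da] /rel_autP[Ab Cb Db]].
  apply/rel_autP; split; first exact: group1.
    by move=> x _; rewrite perm1.
  by move=> x _; rewrite displacementE perm1 mulVg.
apply/rel_autP; split=> [|x Cx|x Ax]; first exact: groupM.
  by rewrite permM Ca ?Cb.
rewrite displacementE permM -(mulKVg (a x) (b (a x))) mulgA -!displacementE.
by rewrite groupM ?Da ?Db ?Aut_closed.
Qed.
Canonical rel_aut A C D := Group (rel_aut_group_set A C D).

Lemma rel_autS A C C' D D' :
  C \subset C' -> D' \subset D -> rel_aut A C' D' \subset rel_aut A C D.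
Proof.
move=> sC sD; apply/subsetP=> a /rel_autP[Aa Ca Da]; apply/rel_autP; split=> //.
  by move=> x /(subsetP sC)/Ca.
by move=> x /Da/(subsetP sD).
Qed.

(** An injective endomorphism of a finite group is onto. *)
Lemma Aut_of_fun A (f : gT -> gT) :
    {in A &, {morph f : x y / x * y}} -> {in A, forall x, f x \in A} ->
    {in A, forall x, f x = 1 -> x = 1} ->
  exists2 a, a \in Aut A & {in A, a =1 f}.
Proof.
move=> fM fA f1; pose phi := Morphism fM.
have inj : 'injm phi.
  apply/subsetP=> x /morphpreP[Ax /set1P fx]; apply/set1P; exact: f1.
have im : phi @* A \subset A.
  by apply/subsetP=> _ /morphimP[x _ Ax ->]; apply: fA.
have im' : phi @* A = A by apply/eqP; rewrite eqEcard im card_injm /=.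
by exists (aut inj im'); [apply: Aut_aut | move=> x Ax; rewrite autE].
Qed.

Section Abelian.

Variable A : {group gT}.
Hypothesis abA : abelian A.

Lemma abelian_mulC : {in A &, commutative (@mulg gT)}.
Proof. by move=> x y Ax Ay; apply: (centsP abA). Qed.

Lemma abelian_mulACA x y z t : x \in A -> y \in A -> z \in A -> t \in A ->
  (x * y) * (z * t) = (x * z) * (y * t).
Proof. by move=> Ax Ay Az At; rewrite -!mulgA (mulgA y) [y * z]abelian_mulC // !mulgA. Qed.

Lemma displacementM a x y : a \in Aut A -> x \in A -> y \in A ->
  displacement a (x * y) = displacement a x * displacement a y.
Proof.
move=> Aa Ax Ay; have [Aax Aay] : a x \in A /\ a y \in A by rewrite !Aut_closed.
rewrite !displacementE (AutM Aa) // invMg [y^-1 * _]abelian_mulC ?groupV //.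
by rewrite abelian_mulACA ?groupV.
Qed.

Lemma displacement_closed a x : a \in Aut A -> x \in A -> displacement a x \in A.
Proof. by move=> Aa Ax; rewrite displacementE groupM ?groupV ?Aut_closed. Qed.

Lemma displacement1 a : a \in Aut A -> displacement a 1 = 1.
Proof. by move=> Aa; rewrite displacementE (Aut_1 Aa) mulVg. Qed.

Lemma displacementX a x n : a \in Aut A -> x \in A ->
  displacement a (x ^+ n) = displacement a x ^+ n.
Proof.
move=> Aa Ax; elim: n => [|n IHn]; first exact: displacement1.
by rewrite !expgS displacementM ?groupX // IHn.
Qed.

Lemma displacement_fix a x : (displacement a x = 1) <-> (a x = x).
Proof.
rewrite displacementE; split=> [e|->]; last by rewrite mulVg.
by rewrite -[LHS](mulKVg x) e mulg1.
Qed.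

(** ab - 1 = (a - 1) + (b - 1) + (b - 1)(a - 1), with a applied first. *)
Lemma displacement_comp a b x : b \in Aut A -> a \in Aut A -> x \in A ->
  displacement (a * b) x =
    displacement a x * displacement b x * displacement b (displacement a x).
Proof.
move=> Ab Aa Ax; have Ad := displacement_closed Aa Ax.
apply: (mulgI x); rewrite displacementK permM -(displacementK a x) (AutM Ab) //.
rewrite -(displacementK b x) -(displacementK b (displacement a x)).
by rewrite abelian_mulACA ?displacement_closed // !mulgA.
Qed.

Lemma displacement_eq1 a : a \in Aut A -> {in A, forall x, displacement a x = 1} -> a = 1.
Proof.
move=> Aa d1; apply: (eq_Aut Aa (group1 _)) => x Ax.
by rewrite perm1; apply/displacement_fix/d1.
Qed.

Lemma eq_displacement a b : a \in Aut A -> b \in Aut A ->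
  {in A, displacement a =1 displacement b} -> a = b.
Proof.
move=> Aa Ab eq_ab; apply: (eq_Aut Aa Ab) => x Ax.
by rewrite -displacementK eq_ab // displacementK.
Qed.

(** The quadratic term vanishes: a - 1 takes values in D, which b fixes. *)
Lemma rel_aut_comp C D C' D' a b x : D \subset C' ->
  a \in rel_aut A C D -> b \in rel_aut A C' D' -> x \in A ->
  displacement (a * b) x = displacement a x * displacement b x.
Proof.
move=> sDC /rel_autP[Aa Ca Da] /rel_autP[Ab Cb Db] Ax.
rewrite displacement_comp // [displacement b (displacement a x)](_ : _ = 1) ?mulg1 //.
by apply/displacement_fix/Cb/(subsetP sDC)/Da.
Qed.

Lemma rel_aut_commute C D C' D' a b : D \subset C' -> D' \subset C ->
  a \in rel_aut A C D -> b \in rel_aut A C' D' -> commute a b.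
Proof.
move=> sDC sDC' Na Nb; have [Aa Ca Da] := rel_autP _ _ _ _ Na.
have [Ab Cb Db] := rel_autP _ _ _ _ Nb.
apply: eq_displacement; rewrite ?groupM // => x Ax.
rewrite (rel_aut_comp sDC Na Nb) // (rel_aut_comp sDC' Nb Na) //.
by rewrite abelian_mulC // displacement_closed.
Qed.

(** The automorphism is 1 + f; the hypothesis about [x * f x = 1] is its injectivity. *)
Lemma rel_autI C D (f : gT -> gT) : D \subset A ->
    {in A &, {morph f : x y / x * y}} -> {in A, forall x, f x \in D} ->
    {in C, forall x, f x = 1} -> {in A, forall x, x * f x = 1 -> f x = 1} ->
    C \subset A ->
  exists2 a, a \in rel_aut A C D & {in A, displacement a =1 f}.
Proof.
move=> sDA fM fD fC f1 sCA.
have fA x : x \in A -> f x \in A by move=> Ax; apply: (subsetP sDA); apply: fD.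
have [|||a Aa Ea] := @Aut_of_fun A (fun x => x * f x).
- by move=> x y Ax Ay; rewrite fM // abelian_mulACA ?fA.
- by move=> x Ax; rewrite groupM ?fA.
- by move=> x Ax e; rewrite -[RHS]e (f1 x Ax e) mulg1.
have Ed : {in A, displacement a =1 f} by move=> x Ax; rewrite displacementE Ea // mulKg.
exists a => //; apply/rel_autP; split=> // x.
  by move=> Cx; rewrite Ea ?(subsetP sCA) // fC // mulg1.
by move=> Ax; rewrite Ed // fD.
Qed.

Section Functional.

Variable p : nat.
Hypothesis p_pr : prime p.

(** A / C is a nonzero vector space over F_p; a coordinate not vanishing at v is divided by its
    value there. Values are natural numbers below p, so that they serve as exponents. *)
Lemma functional C v : C \subset A -> {in A, forall x, x ^+ p \in C} ->
    v \in A -> v \notin C ->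
  exists c : gT -> nat, [/\ forall x, c x < p,
    {in A &, forall x y, c (x * y) = c x + c y %[mod p]},
    c v = 1%N & {in C, forall x, c x = 0%N}].
Proof.
move=> sCA Cp Av C'v.
have nCA : A \subset 'N(C) by rewrite cents_norm // (subset_trans abA) ?centS.
have nCx x : x \in A -> x \in 'N(C) by apply: (subsetP nCA).
have abelAC : p.-abelem (A / C).
  apply/(abelemP p_pr); split; first exact: quotient_abelian.
  by move=> _ /morphimP[x Nx Ax ->]; rewrite -morphX //= coset_id ?Cp.
have nt_v : coset C v != 1 by apply: contra C'v => /eqP/coset_idr->; rewrite ?nCx.
have ntAC : A / C != 1.
  by apply: contraNneq nt_v => AC1; rewrite -in_set1 -[[set 1]]/(1%g : {set _}) -AC1 mem_quotient.
pose r x := abelem_rV abelAC ntAC (coset C x).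
have rM : {in A &, forall x y, r (x * y) = (r x + r y)%R}.
  by move=> x y Ax Ay; rewrite /r morphM ?nCx // abelem_rV_M ?mem_quotient.
have [j vj] : exists j, r v 0%R j != 0%R.
  apply/existsP; apply: contraR nt_v => /existsPn rv0; apply/eqP.
  apply: (@abelem_rV_inj _ _ _ abelAC ntAC); rewrite ?mem_quotient ?group1 //.
  by rewrite abelem_rV_1; apply/rowP=> j; rewrite mxE; apply/eqP/negPn/rv0.
pose c x : nat := (r x 0%R j / r v 0%R j)%R.
exists c; split.
- by move=> x; rewrite -[X in _ < X](Fp_cast p_pr) ltn_ord.
- have valD (a b : 'F_p) : (a + b)%R = (a + b) %% p :> nat.
    by rewrite -[X in _ %% X](Fp_cast p_pr).
  by move=> x y Ax Ay; rewrite /c rM // mxE GRing.mulrDl valD modn_mod.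
- by rewrite /c GRing.divff.
by move=> x Cx; rewrite /c /r coset_id // abelem_rV_1 mxE GRing.mul0r.
Qed.

End Functional.

End Abelian.

End RelAut.

(** * The group N(A, C, L) when L / (L :&: C) is cyclic of order p *)

Section RankOneAut.

Local Open Scope group_scope.

Variables (p : nat) (gT : finGroupType) (A C L : {group gT}) (e : gT) (c : gT -> nat).
Hypotheses (p_pr : prime p) (p_gt3 : 3 < p) (abA : abelian A).
Hypotheses (sCA : C \subset A) (sLA : L \subset A).
Hypotheses (Cp : {in A, forall x, x ^+ p \in C}) (Lp : {in L, forall x, x ^+ p = 1}).
Hypotheses (Le : e \in L) (spanL : {in L, forall x, exists i, x * e ^- i \in C}).
Hypotheses (c_ltp : forall x, c x < p).
Hypothesis cM : {in A &, forall x y, c (x * y) = c x + c y %[mod p]}.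
Hypotheses (ce : c e = 1%N) (cC : {in C, forall x, c x = 0%N}).

Local Notation d := displacement.

Let Ae : e \in A. Proof. exact: (subsetP sLA). Qed.
Let ep : e ^+ p = 1. Proof. exact: Lp. Qed.

Let c1 : c 1 = 0%N. Proof. by rewrite cC. Qed.

Let c_eq0 x : p %| c x -> c x = 0%N.
Proof. by case: (posnP (c x)) => // c_gt0 /dvdn_leq; move: (c_ltp x); lia. Qed.

Let cX x n : x \in A -> c (x ^+ n) = n * c x %[mod p].
Proof.
move=> Ax; elim: n => [|n IHn]; first by rewrite c1.
by rewrite expgS cM ?groupX // -modnDmr IHn modnDmr mulSn.
Qed.

Let ceX n : c (e ^+ n) = n %[mod p].
Proof. by rewrite cX // ce muln1. Qed.

Lemma coordinate_kernel_group_set : group_set [set x in A | c x == 0%N].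
Proof.
apply/group_setP; split=> [|x y]; first by rewrite inE group1 c1.
rewrite !inE => /andP[Ax /eqP cx] /andP[Ay /eqP cy]; rewrite groupM //=.
by apply/eqP/c_eq0; rewrite /dvdn cM // cx cy mod0n.
Qed.
Let A0 := Group coordinate_kernel_group_set.

Let A0P x : reflect (x \in A /\ c x = 0%N) (x \in A0).
Proof. by rewrite inE; apply: (iffP andP) => [[? /eqP]|[? ->]]. Qed.

Let sCA0 : C \subset A0.
Proof. by apply/subsetP=> x Cx; apply/A0P; rewrite (subsetP sCA) ?cC. Qed.

Let W := (L :&: C)%G.
Let sWL : W \subset L. Proof. exact: subsetIl. Qed.
Let sWC : W \subset C. Proof. exact: subsetIr. Qed.
Let sWA0 : W \subset A0. Proof. exact: subset_trans sWC sCA0. Qed.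

Let EL x : x \in L -> x * e ^- c x \in W.
Proof.
move=> Lx; have [i Ci] := spanL Lx; have Ax := subsetP sLA x Lx.
have cx : c x = i %[mod p].
  have -> : x = (x * e ^- i) * e ^+ i by rewrite mulgKV.
  by rewrite cM ?groupM ?groupV ?groupX // cC // add0n ceX.
by rewrite inE groupM ?groupV ?groupX //= (expg_eqmod ep cx).
Qed.

Let E := <[e]>%G.
Let sEL : E \subset L. Proof. by rewrite cycle_subG. Qed.
Let EE x : x \in E -> x = e ^+ c x.
Proof. by case/cycleP=> i ->; apply: expg_eqmod ep _; rewrite ceX. Qed.

Let WL0 x : x \in L -> c x = 0%N -> x \in W.
Proof. by move=> Lx cx; have := EL Lx; rewrite cx expg0 invg1 mulg1. Qed.

Let N := rel_aut A C L.
Let CE := (C <*> E)%G.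
(* In terms of a - 1, these are Hom(A0/C, <e>), Hom(<e>, W) and Hom(A0/C, W). *)
Let X := rel_aut A CE E.
Let Y := rel_aut A A0 W.
Let Z := rel_aut A CE W.

Let sCCE : C \subset CE. Proof. exact: joing_subl. Qed.
Let sECE : E \subset CE. Proof. exact: joing_subr. Qed.
Let CEe : e \in CE. Proof. by apply: (subsetP sECE); apply: cycle_id. Qed.
Let sWCE : W \subset CE. Proof. exact: subset_trans sWC sCCE. Qed.
Let sCEA : CE \subset A. Proof. by rewrite join_subG sCA (subset_trans sEL). Qed.
Let sXN : X \subset N. Proof. exact: rel_autS. Qed.
Let sYN : Y \subset N. Proof. exact: rel_autS. Qed.

Let NA a : a \in N -> a \in Aut A. Proof. by case/rel_autP. Qed.
Let YA a : a \in Y -> a \in Aut A. Proof. by case/rel_autP. Qed.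
Let ZA a : a \in Z -> a \in Aut A. Proof. by case/rel_autP. Qed.

Let CEfix a : a \in Aut A -> a e = e -> {in C, forall x, a x = x} -> {in CE, forall x, a x = x}.
Proof.
move=> Aa ae aC x; rewrite /CE /= cent_joinEl; last first.
  by rewrite (subset_trans sCA) // (subset_trans abA) // centS // (subset_trans sEL).
case/mulsgP=> y _ Cy /cycleP[i ->] ->.
have Ay := subsetP sCA y Cy.
by rewrite (AutM Aa) ?groupX // (AutX _ Aa) // ae aC.
Qed.

Let dX a x : a \in X -> x \in A -> d a x = e ^+ c (d a x).
Proof. by case/rel_autP=> _ _ Da Ax; apply/EE/Da. Qed.

Let Wp x : x \in W -> x ^+ p = 1. Proof. by move/(subsetP sWL); apply: Lp. Qed.
Let WA x : x \in W -> x \in A. Proof. by move/(subsetP sWL)/(subsetP sLA). Qed.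
Let cW x : x \in W -> c x = 0%N. Proof. by move/(subsetP sWC); apply: cC. Qed.

Let cV x : x \in A -> c x + c x^-1 = 0 %[mod p].
Proof. by move=> Ax; rewrite -cM ?groupV // mulgV c1. Qed.

(** A is A0 times <e> and a fixes A0, so a - 1 is determined by its value at e. *)
Let dY a x : a \in Y -> x \in A -> d a x = d a e ^+ c x.
Proof.
move=> Ya Ax; have [Aa Ca Da] := rel_autP _ _ _ _ Ya.
have A0y : x * e ^- c x \in A0.
  apply/A0P; rewrite groupM ?groupV ?groupX //; split=> //; apply: c_eq0.
  rewrite /dvdn cM ?groupV ?groupX //.
  by rewrite -modnDml -(ceX (c x)) modnDml cV ?groupX // mod0n.
have /displacement_fix dy := Ca _ A0y.
by rewrite -{1}(mulgKV (e ^+ c x) x) (displacementM abA) ?groupM ?groupV ?groupX // dy mul1g (displacementX abA).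
Qed.

Let mulA x y : x \in A -> y \in A -> x * y = y * x.
Proof. exact: abelian_mulC. Qed.

Let dA a x : a \in Aut A -> x \in A -> d a x \in A.
Proof. exact: displacement_closed. Qed.

(** 1 + h e is injective: x = -h(x) e would lie in <e>, where h vanishes. *)
Lemma ex_functional_row (h : gT -> nat) (D : {group gT}) :
  {in A &, forall x y, h (x * y) = h x + h y %[mod p]} ->
  (forall x, h x < p) -> {in D, forall x, h x = 0%N} -> CE \subset D -> D \subset A ->
  exists2 a, a \in X & {in A, forall x, d a x = e ^+ h x}.
Proof.
move=> hM h_ltp hD sCED sDA.
have hCE x : x \in CE -> h x = 0%N by move/(subsetP sCED)/hD.
apply: (rel_autI abA (subset_trans sEL sLA)) => // [x y Ax Ay|x Ax|x CEx|x Ax].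
- by rewrite -expgD; apply: expg_eqmod ep _; apply: hM.
- exact: mem_cycle.
- by rewrite hCE.
move/(canRL (mulgK _)); rewrite mul1g => ->.
by rewrite hCE ?expg0 // (subsetP sECE) // groupV mem_cycle.
Qed.

(** 1 + c w is injective: c kills w, so x = -c(x) w forces c(x) = 0. *)
Lemma ex_functional_column w : w \in W ->
  exists2 a, a \in Y & {in A, forall x, d a x = w ^+ c x}.
Proof.
move=> Ww; apply: (rel_autI abA (subset_trans sWL sLA)) => [x y Ax Ay|x Ax|x A0x|x Ax|].
- by rewrite -expgD; apply: expg_eqmod (Wp Ww) _; apply: cM.
- exact: groupX.
- by have [_ ->] := A0P _ A0x.
- move/(canRL (mulgK _)); rewrite mul1g => ->.
  by rewrite cW ?expg0 // groupV groupX.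
by apply/subsetP=> x /A0P[].
Qed.

(** xy and yx differ by the quadratic term (y - 1)(x - 1); the other one, (x - 1)(y - 1), vanishes
    because y - 1 takes values in W, which x fixes. *)
Lemma commg_row_column x y : x \in X -> y \in Y ->
  [~ x, y] \in Z /\ {in A, forall u, d [~ x, y] u = d y (d x u)}.
Proof.
move=> Xx Yy; have [Ax CEx Dx] := rel_autP _ _ _ _ Xx.
have [Ay A0y Dy] := rel_autP _ _ _ _ Yy.
have [||||||r Zr Er] := @rel_autI _ A abA CE W (fun u => d y (d x u)).
- exact: subset_trans sWL sLA.
- by move=> u v Au Av; rewrite !(displacementM abA) ?dA.
- by move=> u Au; apply: Dy; apply: dA.
- by move=> u CEu; rewrite (proj2 (displacement_fix x u) (CEx _ CEu)) (displacement1 Ay).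
- move=> u Au /(canRL (mulgK _)); rewrite mul1g => eu.
  have CEu : u \in CE by rewrite eu (subsetP sWCE) // groupV Dy ?dA.
  by rewrite (proj2 (displacement_fix x u) (CEx _ CEu)) (displacement1 Ay).
- exact: sCEA.
have -> : [~ x, y] = r; last by [].
apply: (mulgI (y * x)); rewrite -commgC; apply: (@eq_displacement _ A); rewrite ?groupM ?(ZA Zr) //.
move=> u Au; have [_ CEr _] := rel_autP _ _ _ _ Zr.
rewrite (displacement_comp abA) // (displacement_comp abA) ?groupM ?(ZA Zr) //.
rewrite (rel_aut_comp abA _ Yy Xx) // Er //.
rewrite (proj2 (displacement_fix r _)) ?mulg1; last first.
  apply: CEr; rewrite groupM // ?(subsetP sWCE _ (Dy _ _)) // (subsetP sECE) //; exact: Dx.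
by rewrite [d y u * _]mulA ?dA.
Qed.

(* If z moves v, multiplying z by a commutator r with the same displacement at v
   shrinks the set of elements that z moves. *)
Lemma central_sub_commg : Z \subset [~: X, Y].
Proof.
apply/subsetP=> z; have [n] := ubnP #|[set u in A | d z u != 1]|.
elim: n z => // n IHn z; rewrite ltnS => le_n Zz.
have [Az CEz Dz] := rel_autP _ _ _ _ Zz.
have [/set0Pn[v]|/negPn/eqP/setP z1] := boolP ([set u in A | d z u != 1] != set0); last first.
  rewrite (@displacement_eq1 _ A z) ?group1 // => u Au.
  by have:= z1 u; rewrite !inE Au /= => /negbFE/eqP.
rewrite inE => /andP[Av zv].
(* K is the fixed subgroup of z. For h zero on K with h v = 1, the commutator of the row h and the
   column with value d z v has displacement h(u) (d z v) at u: it agrees with z at v and is trivial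
   on K. *)
have gK : group_set [set u in A | d z u == 1].
  apply/group_setP; split=> [|u w]; first by rewrite inE group1 (displacement1 Az) eqxx.
  rewrite !inE => /andP[Au /eqP zu] /andP[Aw /eqP zw].
  by rewrite groupM //= (displacementM abA) // zu zw mulg1.
pose K := Group gK.
have sKA : K \subset A by apply/subsetP=> u; rewrite inE => /andP[].
have sCEK : CE \subset K.
  apply/subsetP=> u CEu; rewrite inE (subsetP sCEA) //=.
  by apply/eqP/displacement_fix/CEz.
have [|||h [h_ltp hM hv hK]] := @functional _ A abA p p_pr K v sKA.
- by move=> u Au; apply: (subsetP sCEK); apply: (subsetP sCCE); apply: Cp.
- by [].
- by rewrite inE negb_and zv orbT.
have [x Xx Ex] := ex_functional_row hM h_ltp hK sCEK sKA.
have [y Yy Ey] := ex_functional_column (Dz v Av).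
have [Zr Er] := commg_row_column Xx Yy.
have Rr := mem_commg Xx Yy.
set r := [~ x, y] in Zr Er Rr.
have Er' u : u \in A -> d r u = d z v ^+ h u.
  move=> Au; rewrite Er // Ex // Ey ?groupX //.
  by apply: expg_eqmod (Wp (Dz v Av)) _; rewrite ceX.
rewrite -(mulgKV r z) groupM //; apply: IHn; last by rewrite groupM ?groupV.
have Zz' : z * r^-1 \in Z by rewrite groupM ?groupV.
have Ez' u : u \in A -> d z u = d (z * r^-1) u * d r u.
  by move=> Au; rewrite -(rel_aut_comp abA sWCE Zz' Zr Au) mulgKV.
apply: leq_trans le_n; apply/proper_card/properP; split.
  apply/subsetP=> u; rewrite !inE => /andP[Au]; rewrite Au; apply: contra => /eqP zu.
  have Ku : u \in K by rewrite inE Au zu eqxx.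
  by have := Ez' u Au; rewrite zu Er' // hK // mulg1 => <-.
exists v; rewrite !inE Av //= negbK; apply/eqP.
by have := Ez' v Av; rewrite Er' // hv expg1 => /(canLR (mulgK _)) <-; rewrite mulgV.
Qed.

(** Matrix elimination: x removes the e-component h of a - 1, then y removes the value at e, and
    what is left lies in Z, hence in [X, Y]. *)
Lemma unipotent_sub_joing a : a \in N -> c (a e) = 1%N -> a \in X <*> Y.
Proof.
move=> Na cae; have [Aa Ca Da] := rel_autP _ _ _ _ Na.
have La : {in A, forall u, d a u \in L} by [].
have Wae : d a e \in W.
  apply: WL0; rewrite ?Da //; apply: c_eq0.
  have: c (a e) = c e + c (d a e) %[mod p] by rewrite -cM ?dA // displacementK.
  by rewrite cae ce -{1}[1%N]addn0 => /eqP; rewrite eqn_modDl mod0n eq_sym.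
pose h u := c (d a u).
have hM : {in A &, forall x y, h (x * y) = h x + h y %[mod p]}.
  by move=> x y Ax Ay; rewrite /h (displacementM abA) // cM ?dA.
have h_ltp u : h u < p by apply: c_ltp.
have he : h e = 0%N by rewrite /h cW.
have hCE : {in CE, forall x, h x = 0%N}.
  rewrite /CE /= cent_joinEl; last first.
    by rewrite (subset_trans sCA) // (subset_trans abA) // centS // (subset_trans sEL).
  move=> _ /mulsgP[y _ Cy /cycleP[i ->] ->]; have Ay := subsetP sCA y Cy.
  apply: c_eq0; rewrite -/(h _) /dvdn hM ?groupX //.
  rewrite {1}/h (proj2 (displacement_fix a y)) ?Ca // c1 add0n.
  by rewrite /h (displacementX abA) // cX ?dA // -/(h e) he muln0 mod0n.
have [x Xx Ex] := ex_functional_row hM h_ltp hCE (subxx _) sCEA.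
pose b := x^-1 * a.
have Nx := subsetP sXN x Xx.
have Nb : b \in N by rewrite groupM ?groupV.
have [Ab Cb Db] := rel_autP _ _ _ _ Nb.
have [Ax CEx Dx] := rel_autP _ _ _ _ Xx.
have Ea u : u \in A -> d a u = e ^+ h u * d b u * d b e ^+ h u.
  move=> Au; rewrite -{1}(mulKVg x a) -/b (displacement_comp abA) // Ex //.
  by rewrite (displacementX abA).
have Ebe : d b e = d a e by rewrite Ea // he !expg0 mul1g mulg1.
have Wb u : u \in A -> d b u \in W.
  move=> Au; have Wbe : d b e \in W by rewrite Ebe.
  apply: WL0; first exact: Db; apply: c_eq0.
  have: h u = h u + c (d b u) %[mod p].
    rewrite {1}/h Ea // cM ?groupM ?groupX ?dA // -modnDmr cX ?dA // (cW Wbe) muln0 mod0n addn0.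
    by rewrite cM ?groupX ?dA // -modnDml ceX modnDml.
  by rewrite -{1}[h u]addn0 => /eqP; rewrite eqn_modDl mod0n eq_sym.
have [y Yy Ey] := ex_functional_column (Wb e Ae).
pose z := y^-1 * b.
have Nz : z \in N by rewrite groupM ?groupV // (subsetP sYN).
have [Az Cz Dz] := rel_autP _ _ _ _ Nz.
have Eb u : u \in A -> d b u = d b e ^+ c u * d z u.
  move=> Au; rewrite -{1}(mulKVg y b) -/z (rel_aut_comp abA sWC Yy Nz) //.
  by rewrite Ey.
have ze : d z e = 1.
  by apply: (mulgI (d b e)); rewrite mulg1 [RHS](Eb e Ae) ce expg1.
have Zz : z \in Z.
  apply/rel_autP; split=> // [|u Au]; last first.
    by rewrite -(mulKg (d b e ^+ c u) (d z u)) -Eb // groupM ?groupV ?groupX ?Wb.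
  by apply: CEfix => //; apply/displacement_fix.
have -> : a = x * (y * z) by rewrite /z /b !mulKVg.
have sXJ := joing_subl X Y; have sYJ := joing_subr X Y.
rewrite groupM ?(subsetP sXJ x Xx) // groupM ?(subsetP sYJ y Yy) //.
have sZJ : Z \subset X <*> Y; last exact: (subsetP sZJ).
by rewrite (subset_trans central_sub_commg) // (subset_trans _ (der1_subG (X <*> Y))) // commgSS.
Qed.

(** On L, applying a multiplies c by c (a e) modulo p. For a of order p^r, Fermat gives c (a e) = c
    (a e)^(p^r) = 1, so a Sylow p-subgroup lies in <X, Y>. *)
Lemma coprime_index_rank_one : coprime p #|N : X <*> Y|.
Proof.
have [P sylP] := Sylow_exists p N.
have [sPN pP _] := and3P sylP.
suffices sPJ : P \subset X <*> Y.
  have sJN : X <*> Y \subset N by rewrite join_subG sXN sYN.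
  have: #|N : X <*> Y| %| #|N : P| by apply: indexgS.
  by move/coprime_dvdr; apply; have [_ _] := and3P sylP; rewrite p'natE // -prime_coprime.
apply/subsetP=> a Pa; have Na := subsetP sPN a Pa.
apply: unipotent_sub_joing => //.
have [Aa Ca Da] := rel_autP _ _ _ _ Na.
have ca n : c ((a ^+ n) e) = c (a e) ^ n %[mod p].
  elim: n => [|n IHn]; first by rewrite expg0 perm1 ce.
  rewrite expgSr permM.
  have [An Cn Dn] := rel_autP _ _ _ _ (groupX n Na).
  have Le_n : (a ^+ n) e \in L by rewrite -(displacementK (a ^+ n) e) groupM ?Dn.
  set u := (a ^+ n) e in IHn Le_n *.
  have Au := subsetP sLA u Le_n.
  have Wu := EL Le_n; have Cu := subsetP sWC _ Wu.
  have -> : a u = u * e ^- c u * a e ^+ c u.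
    rewrite -{1}(mulgKV (e ^+ c u) u) (AutM Aa) ?groupM ?groupV ?groupX //.
    by rewrite Ca // (AutX _ Aa).
  rewrite cM ?(WA Wu) ?groupX ?Aut_closed // (cW Wu) add0n cX ?Aut_closed //.
  by rewrite expnS mulnC -modnMmr IHn modnMmr mulnC.
have [r ar] := p_natP (mem_p_elt pP Pa).
have := ca #[a]; rewrite expg_order perm1 ce ar.
have -> : c (a e) ^ (p ^ r) = c (a e) %[mod p].
  elim: r {ar} => [|r IHr]; first by rewrite expn0 expn1.
  by rewrite expnSr expnM -[LHS]modnXm IHr modnXm fermat_little.
by rewrite !modn_small ?prime_gt1 ?c_ltp // => <-.
Qed.

(** s = 1 + c e doubles e and fixes C. Conjugation by s doubles X, halves Y and is trivial on Z. *)
Lemma rank_one_rel_aut_coordinate : low_acyclic p N.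
Proof.
have [||||||s Ns Es] := @rel_autI _ A abA C L (fun u => e ^+ c u) => //.
- by move=> x y Ax Ay; rewrite -expgD; apply: expg_eqmod ep _; apply: cM.
- by move=> x _; apply: groupX.
- by move=> x Cx; rewrite cC.
(* Injectivity of s: x = -c(x) e gives 2 c(x) = 0 modulo p, and p does not divide 2. *)
- move=> x Ax ex; have ex' : x = e ^- c x by apply: (mulIg (e ^+ c x)); rewrite mulVg.
  have: c x + c (e ^+ c x) = 0 %[mod p] by rewrite -cM ?groupX // ex c1.
  rewrite -modnDmr ceX modnDmr addnn -muln2 => /eqP; rewrite mod0n -/(dvdn _ _).
  have p'2 : ~~ (p %| 2) by rewrite gtnNdvd // (ltn_trans _ p_gt3).
  rewrite Euclid_dvdM // (negPf p'2) orbF.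
  by move/c_eq0=> ->.
have As := NA Ns; have [_ Cs Ds] := rel_autP _ _ _ _ Ns.
have sXC u : u \in E -> d s u = u.
  move=> Eu; have Au : u \in A by apply: (subsetP sLA); apply: (subsetP sEL).
  by rewrite Es //; apply: esym (EE Eu).
have sC u : u \in C -> d s u = 1 by move=> Cu; apply/displacement_fix/Cs.
have did (u : gT) : d 1 u = 1 by rewrite displacementE perm1 mulVg.
have d1P (a : {perm gT}) (u : gT) : d a u = 1 <-> a u = u := displacement_fix a u.
apply: (@rank_one_low_acyclic p p_pr p_gt3 _ N X Y Z s) => //.
- by apply/centsP=> a Xa b Xb; apply: rel_aut_commute sECE sECE Xa Xb.
- by apply/centsP=> a Ya b Yb; apply: rel_aut_commute sWA0 sWA0 Ya Yb.
- move=> x Xx; have [Ax CEx Dx] := rel_autP _ _ _ _ Xx.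
  suffices e2 : x * s = s * (x * x) by rewrite conjgE e2 mulKg.
  apply: (@eq_displacement _ A); rewrite ?groupM // => u Au.
  rewrite (displacement_comp abA) // [in RHS](displacement_comp abA) ?groupM //.
  rewrite !(rel_aut_comp abA sECE Xx Xx) ?dA // (sXC (d x u)) ?Dx //.
  rewrite [d x (d s u)](_ : _ = 1) ?mulg1; last first.
    by apply/d1P/CEx; rewrite Es // groupX.
  by rewrite [d x u * _]mulA ?dA // mulgA.
- move=> y Yy; have [Ay A0y Dy] := rel_autP _ _ _ _ Yy.
  suffices e2 : s * y = (y * y) * s by rewrite conjgE invgK mulgA e2 mulgK.
  apply: (@eq_displacement _ A); rewrite ?groupM // => u Au.
  rewrite (displacement_comp abA) // [in RHS](displacement_comp abA) ?groupM //.
  rewrite !(rel_aut_comp abA sWA0 Yy Yy) ?dA //.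
  rewrite [d s (_ * _)]sC ?mulg1; last by apply: (subsetP sWC); rewrite groupM ?Dy.
  have -> : d y (d s u) = d y u by rewrite Es // (displacementX abA) // -dY.
  by rewrite -!mulgA; rewrite mulA ?groupM ?dA // mulgA.
- by rewrite gen_subG; apply/subsetP=> _ /imset2P[x y Xx Yy ->]; case: (commg_row_column Xx Yy).
- by apply/centsP=> a Za b Xb; apply: rel_aut_commute sWCE sECE Za Xb.
- by apply/centsP=> a Za b Yb; apply: rel_aut_commute sWA0 sWCE Za Yb.
- apply/subsetP=> z Zz; have [Az CEz Dz] := rel_autP _ _ _ _ Zz.
  apply/cent1P; apply: (@eq_displacement _ A); rewrite ?groupM // => u Au.
  rewrite (displacement_comp abA) // [in RHS](displacement_comp abA) ?groupM //.
  rewrite (sC (d z u)) ?(subsetP sWC) ?Dz // (proj2 (d1P z (d s u))) ?mulg1 1?mulA ?dA //.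
  by apply: CEz; rewrite Es // groupX.
- move=> x y z Xx Yy Zz xyz1.
  have [Ax CEx Dx] := rel_autP _ _ _ _ Xx; have [Ay A0y Dy] := rel_autP _ _ _ _ Yy.
  have [Az CEz Dz] := rel_autP _ _ _ _ Zz.
  have ye : d y e = 1.
    have: (x * y * z) e = e by rewrite xyz1 perm1.
    rewrite !permM CEx // -(displacementK y e) (AutM Az) ?dA // CEz // CEz ?(subsetP sWCE) ?Dy //.
    by move=> e2; apply: (mulgI e); rewrite mulg1.
  have y1 : y = 1 by apply: (@displacement_eq1 _ A) => // u Au; rewrite (dY Yy) // ye expg1n.
  split=> //; apply: (@displacement_eq1 _ A) => // u Au.
  have: d (x * z) u = 1 by move: xyz1; rewrite y1 mulg1 => ->; apply: did.
  rewrite (rel_aut_comp abA sECE Xx Zz) // => /(canRL (mulgK _)); rewrite mul1g => xz.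
  by rewrite (dX Xx) // cW ?expg0 // xz groupV Dz.
- move=> x Xx nt_x; have [Ax CEx Dx] := rel_autP _ _ _ _ Xx.
  have /exists_inP[u Au xu] : [exists u in A, d x u != 1].
    apply: contraR nt_x => /exists_inPn d1; apply/eqP/(@displacement_eq1 _ A) => // u Au.
    exact/eqP/negPn/d1.
  (* For [tensor] the functional is x' -> c (d x' v), where d x v = e: at v the commutator [x', y']
     has displacement c (d x' v) times that of y' at e. *)
  have [v Av xv] : exists2 v, v \in A & d x v = e.
    have co : coprime (c (d x u)) p.
      rewrite coprime_sym prime_coprime //; apply: contra xu => /c_eq0 c0.
      by rewrite (dX Xx) // c0.
    have [k Ek] : exists k, c (d x u) * k = 1 %[mod p].
      have [|k l Ekl _] := egcdnP p (m := c (d x u)).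
        by rewrite lt0n; apply: contraNneq xu => c0; rewrite (dX Xx) // c0.
      by exists k; rewrite mulnC Ekl (eqP co) modnMDl.
    exists (u ^+ k); first exact: groupX.
    by rewrite (displacementX abA) // (dX Xx) // -expgM -{2}(expg1 e); apply: expg_eqmod ep _.
  exists (fun x' => c (d x' v)); first by rewrite xv.
  move=> l all_l l1.
  suffices [Zl Yl El] : [/\ commg_prod l \in Z, \prod_(i <- l) i.2 ^+ c (d i.1 v) \in Y
      & d (commg_prod l) v = d (\prod_(i <- l) i.2 ^+ c (d i.1 v)) e].
    apply: (@displacement_eq1 _ A) => [|w Aw]; first exact: YA.
    by rewrite (dY Yl) // -El l1 did expg1n.
  rewrite /commg_prod; elim: l all_l {l1} => [|[x' y'] l IHl] /=.
    by rewrite !big_nil !group1 !did.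
  case/andP=> /andP[Xx' Yy'] /IHl[Zl Yl El]; rewrite !big_cons /=.
  have [Zr Er] := commg_row_column Xx' Yy'.
  have Yy'X n : y' ^+ n \in Y by apply: groupX.
  split; [exact: groupM Zr Zl | exact: groupM (Yy'X _) Yl |].
  rewrite (rel_aut_comp abA sWCE Zr Zl) // (rel_aut_comp abA sWA0 (Yy'X _) Yl) //.
  rewrite El Er //; congr (_ * _).
  rewrite {1}(dX Xx') // (displacementX abA) ?YA //.
  elim: (c _) => [|n IHn]; first by rewrite !expg0 did.
  by rewrite !expgS IHn (rel_aut_comp abA sWA0 Yy' (Yy'X n)).
exact: coprime_index_rank_one.
Qed.

End RankOneAut.

(** * Extension of automorphisms *)

Section Extensions.

Local Open Scope group_scope.

Variables (p : nat) (gT : finGroupType).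
Hypothesis p_pr : prime p.
Implicit Types (A B C D L : {group gT}) (e u x y : gT).

Lemma rank_one_rel_aut A C L e : 3 < p -> abelian A -> C \subset A -> L \subset A ->
  {in A, forall x, x ^+ p \in C} -> {in L, forall x, x ^+ p = 1} ->
  e \in L -> e \notin C -> {in L, forall x, exists i, x * e ^- i \in C} ->
  low_acyclic p (rel_aut A C L).
Proof.
move=> p_gt3 abA sCA sLA Cp Lp Le C'e span.
have [c [c_ltp cM ce cC]] := functional abA p_pr sCA Cp (subsetP sLA e Le) C'e.
exact: (rank_one_rel_aut_coordinate p_pr p_gt3 abA sCA sLA Cp Lp Le span c_ltp cM ce cC).
Qed.

Lemma hom_1 B (phi : gT -> gT) : {in B &, {morph phi : u v / u * v}} -> phi 1 = 1.
Proof. by move=> phiM; apply: (mulgI (phi 1)); rewrite -phiM ?group1 // !mulg1. Qed.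

Lemma hom_X B (phi : gT -> gT) u n :
  {in B &, {morph phi : u v / u * v}} -> u \in B -> phi (u ^+ n) = phi u ^+ n.
Proof.
move=> phiM Bu; elim: n => [|n IHn]; first exact: hom_1 phiM.
by rewrite !expgS phiM ?groupX // IHn.
Qed.

Lemma hom_V B (phi : gT -> gT) u :
  {in B &, {morph phi : u v / u * v}} -> u \in B -> phi u^-1 = (phi u)^-1.
Proof.
move=> phiM Bu; apply: (mulgI (phi u)).
by rewrite -phiM ?groupV // !mulgV (hom_1 phiM).
Qed.

Lemma abelian_joing_cycleP A B x u : abelian A -> B \subset A -> x \in A ->
  reflect (exists2 b, b \in B & exists i, u = b * x ^+ i) (u \in B <*> <[x]>).
Proof.
move=> abA sBA Ax.
rewrite cent_joinEl; last first.
  by rewrite (subset_trans sBA) // (subset_trans abA) // centS // cycle_subG.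
apply: (iffP mulsgP) => [[b _ Bb /cycleP[i ->] ->]|[b Bb [i ->]]].
  by exists b => //; exists i.
by exists b (x ^+ i); rewrite ?mem_cycle.
Qed.

(** B<x> / B has order p, so a functional with value 1 at x gives every element a normal form b x^c;
    moving x^p between the factors is harmless as y^p = phi (x^p). *)
Lemma extend_hom A B x y (phi : gT -> gT) :
    abelian A -> B \subset A -> x \in A -> x \notin B -> x ^+ p \in B ->
    {in B &, {morph phi : u v / u * v}} -> {in B, forall u, phi u \in A} ->
    y \in A -> y ^+ p = phi (x ^+ p) ->
  exists psi : gT -> gT, [/\ {in B <*> <[x]> &, {morph psi : u v / u * v}},
     {in B <*> <[x]>, forall u, psi u \in A}
   & forall b i, b \in B -> psi (b * x ^+ i) = phi b * y ^+ i].
Proof.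
move=> abA sBA Ax B'x Bxp phiM phiA Ay yp.
have xiP u := @abelian_joing_cycleP A B x u abA sBA Ax.
pose B' := (B <*> <[x]>)%G.
have sB'A : B' \subset A by rewrite join_subG sBA cycle_subG.
have sBB' : B \subset B' by apply: joing_subl.
have B'x' : x \in B' by apply: (subsetP (joing_subr B _)); apply: cycle_id.
have B'p : {in B', forall u, u ^+ p \in B}.
  move=> u /xiP[b Bb [i ->]]; rewrite expgMn; last first.
    by apply: (centsP abA); rewrite ?groupX // (subsetP sBA).
  by rewrite groupM ?(groupX p Bb) // -expgM mulnC expgM groupX.
have [c [c_ltp cM cx cB]] := functional (abelianS sB'A abA) p_pr sBB' B'p B'x' B'x.
have cxX n : c (x ^+ n) = n %[mod p].
  elim: n => [|n IHn]; first by rewrite expg0 cB ?group1.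
  by rewrite expgS cM ?groupX // -modnDmr IHn modnDmr cx.
have cbx b i : b \in B -> c (b * x ^+ i) = i %% p.
  move=> Bb; rewrite -(modn_small (c_ltp _)) cM ?groupX ?(subsetP sBB' b Bb) //.
  by rewrite cB // add0n cxX.
pose psi u := phi (u * x ^- c u) * y ^+ c u.
have psiE b i : b \in B -> psi (b * x ^+ i) = phi b * y ^+ i.
  move=> Bb; rewrite /psi cbx // {1 4}(divn_eq i p).
  rewrite !expgD !mulgA mulgK [(_ * p)%N]mulnC !expgM phiM ?(groupX (i %/ p) Bxp) //.
  by rewrite (hom_X _ phiM) // -yp.
exists psi; split=> //.
  move=> _ _ /xiP[b Bb [i ->]] /xiP[b' Bb' [i' ->]].
  have [Ab Ab'] := (subsetP sBA b Bb, subsetP sBA b' Bb').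
  rewrite (abelian_mulACA abA) ?groupX // -expgD !psiE ?groupM // phiM // expgD.
  by rewrite (abelian_mulACA abA) ?groupX ?phiA.
by move=> _ /xiP[b Bb [i ->]]; rewrite psiE // groupM ?groupX ?phiA.
Qed.

(** One element is adjoined at a time; [Inv] carries the properties of the partial homomorphism. *)
Lemma extension_induction A C (Inv : {group gT} -> (gT -> gT) -> Prop) :
    C \subset A ->
    (forall B phi x, C \subset B -> B \subset A -> x \in A -> x \notin B -> Inv B phi ->
      exists psi, Inv (B <*> <[x]>)%G psi) ->
  forall alpha, Inv C alpha -> exists psi, Inv A psi.
Proof.
move=> sCA step alpha InvC.
suffices ext n B phi : #|A| - #|B| < n -> C \subset B -> B \subset A -> Inv B phi ->
    exists psi, Inv A psi by apply: (ext _ C alpha (ltnSn _)).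
elim: n B phi => // n IHn B phi le_n sCB sBA InvB.
have [sAB | /subsetPn[x Ax B'x]] := boolP (A \subset B).
  have -> : A = B by apply: val_inj; apply/eqP; rewrite /= eqEsubset sAB sBA.
  by exists phi.
have [psi Inv'] := step B phi x sCB sBA Ax B'x InvB.
apply: (IHn _ psi _ _ _ Inv'); last by rewrite join_subG sBA cycle_subG.
  have ltB : #|B| < #|B <*> <[x]>|.
    apply/proper_card/properP; split; first exact: joing_subl.
    by exists x => //; apply: (subsetP (joing_subr B _)); apply: cycle_id.
  have leA : #|B <*> <[x]>| <= #|A|.
    by apply: subset_leq_card; rewrite join_subG sBA cycle_subG.
  rewrite ltnS in le_n; apply: leq_trans le_n.
  by apply: ltn_sub2l => //; apply: leq_trans leA.
by rewrite (subset_trans sCB) ?joing_subl.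
Qed.

(** Each new generator x is sent to itself, which is consistent since a fixes x^p in C; no new
    displacements arise. *)
Lemma rel_aut_extend A C C' D a : abelian A -> C \subset C' -> C' \subset A ->
    {in A, forall x, x ^+ p \in C} -> D \subset C' -> a \in rel_aut C' C D ->
  exists2 b, b \in rel_aut A C D & {in C', a =1 b}.
Proof.
move=> abA sCC' sC'A Cp sDC' /rel_autP[Aa Ca Da].
pose Inv (B : {group gT}) (phi : gT -> gT) := [/\ C' \subset B,
  {in B &, {morph phi : u v / u * v}}, {in C', a =1 phi},
  {in B, forall u, u^-1 * phi u \in D} & {in B, forall u, phi u = 1 -> u = 1}].
have step B phi x : C' \subset B -> B \subset A -> x \in A -> x \notin B ->
    Inv B phi -> exists psi, Inv (B <*> <[x]>)%G psi.
  move=> sC'B sBA Ax B'x [_ phiM phia phiD phi1].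
  have xiP u := @abelian_joing_cycleP A B x u abA sBA Ax.
  have phiB u : u \in B -> phi u \in B.
    move=> Bu; rewrite -(mulKVg u (phi u)) groupM //.
    by apply: (subsetP sC'B); apply: (subsetP sDC'); apply: phiD.
  have Cxp := Cp x Ax; have C'xp := subsetP sCC' _ Cxp.
  have [|||psi [psiM psiA psiE]] := @extend_hom A B x x phi abA sBA Ax B'x _ phiM _ Ax.
  - exact: (subsetP sC'B).
  - by move=> u Bu; apply: (subsetP sBA); apply: phiB.
  - by rewrite -phia // Ca.
  have psiB u : u \in B -> psi u = phi u.
    by move=> Bu; have := psiE u 0 Bu; rewrite !expg0 !mulg1.
  exists psi; split=> //.
  - by rewrite (subset_trans sC'B) ?joing_subl.
  - by move=> u C'u; rewrite phia // psiB // (subsetP sC'B).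
  - move=> _ /xiP[b Bb [i ->]]; rewrite psiE //.
    have [Ab Apb] := (subsetP sBA b Bb, subsetP sBA _ (phiB b Bb)).
    have Abx : b * x ^+ i \in A by rewrite groupM ?groupX.
    have Aphix : phi b * x ^+ i \in A by rewrite groupM ?groupX.
    rewrite (abelian_mulC abA (groupVr Abx)) // invMg mulgA mulgK.
    by rewrite (abelian_mulC abA) ?groupV // phiD.
  move=> _ /xiP[b Bb [i ->]] => e1.
  have Bbx : b * x ^+ i \in B.
    move: e1; rewrite psiE // => /(canRL (mulKg _)).
    by rewrite mulg1 => ->; rewrite groupM ?groupV ?phiB.
  by apply: phi1; rewrite // -psiB.
have [|psi [_ psiM psia psiD psi1]] := @extension_induction A C' Inv sC'A step a.
- split=> // [u v C'u C'v|u C'u|u C'u]; first exact: AutM Aa _ _.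
    by rewrite -displacementE Da.
  by move=> au1; apply: (@perm_inj _ a); rewrite au1 (Aut_1 Aa).
have [|b Ab Eb] := Aut_of_fun psiM _ psi1.
  by move=> u Au; rewrite -(mulKVg u (psi u)) groupM // (subsetP (subset_trans sDC' sC'A)) ?psiD.
have Eab : {in C', a =1 b} by move=> u C'u; rewrite psia // Eb // (subsetP sC'A).
exists b => //; apply/rel_autP; split=> // [x Cx|x Ax].
  by rewrite -Eab ?Ca // (subsetP sCC').
by rewrite displacementE Eb // psiD.
Qed.

(** A new generator x must go to a p-th root y of phi (x^p), and injectivity requires y outside phi
    (B). A root exists because C is the set of p-th powers. *)
Lemma Aut_powers_extend A C a : abelian A -> C \subset A ->
    (forall x, reflect (exists2 y, y \in A & x = y ^+ p) (x \in C)) -> a \in Aut C ->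
  exists2 b, b \in Aut A & {in C, a =1 b}.
Proof.
move=> abA sCA CP Aa.
have Cp x : x \in A -> x ^+ p \in C by move=> Ax; apply/CP; exists x.
pose Inv (B : {group gT}) (phi : gT -> gT) := [/\ C \subset B,
  {in B &, {morph phi : u v / u * v}}, {in C, a =1 phi},
  {in B, forall u, phi u \in A} & {in B, forall u, phi u = 1 -> u = 1}].
have step B phi x : C \subset B -> B \subset A -> x \in A -> x \notin B ->
    Inv B phi -> exists psi, Inv (B <*> <[x]>)%G psi.
  move=> sCB sBA Ax B'x [_ phiM phia phiA phi1].
  have xiP u := @abelian_joing_cycleP A B x u abA sBA Ax.
  have sB u : u \in B -> u \in A := subsetP sBA u.
  have phi_inj u v : u \in B -> v \in B -> phi u = phi v -> u = v.
    move=> Bu Bv e; apply/eqP; rewrite eq_mulgV1; apply/eqP/phi1; rewrite ?groupM ?groupV //.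
    by rewrite phiM ?groupV // (hom_V phiM) // e mulgV.
  have Bxp : x ^+ p \in B by apply: (subsetP sCB); apply: Cp.
  have [y [Ay yp phi'y]] : exists y, [/\ y \in A, y ^+ p = phi (x ^+ p)
      & forall b, b \in B -> phi b <> y].
    have /CP[y0 Ay0 Ey0] : a (x ^+ p) \in C by apply: Aut_closed (Cp x Ax).
    have Ey : phi (x ^+ p) = y0 ^+ p by rewrite -phia ?Cp.
    have [/exists_inP[b0 Bb0 /eqP Eb0] | /exists_inPn out] := boolP [exists b in B, phi b == y0]; last first.
      by exists y0; split=> // b Bb /eqP; apply/negP/out.
    (* If the root y0 is phi b0, then x b0^-1 is p-torsion outside B. So A has more p-torsion than
       B, some p-torsion d lies outside the image of that of B, and y0 d is the root sought. *)
    pose D := [set u in A | u ^+ p == 1].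
    have Dx : x * b0^-1 \in D :\: B.
      rewrite !inE groupMr ?groupV // B'x groupM ?groupV ?(sB b0 Bb0) //=.
      rewrite expgMn; last by apply: (centsP abA); rewrite ?groupV ?(sB b0 Bb0).
      rewrite expVgn -eq_mulgV1; apply/eqP/phi_inj => //; first exact: groupX.
      by rewrite (hom_X _ phiM Bb0) Eb0.
    have [d Dd out] : exists2 d, d \in D & d \notin phi @: (D :&: B).
      apply/subsetPn; apply: contraTN Dx => /subset_leq_card le_D.
      have: #|D| <= #|D :&: B| by apply: leq_trans le_D (leq_imset_card _ _).
      rewrite -(cardsID B D) -{2}(addn0 #|_|) leq_add2l leqn0 cards_eq0 => /eqP->.
      by rewrite inE.
    move: Dd; rewrite inE => /andP[Ad /eqP dp].
    exists (y0 * d); split; first exact: groupM.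
      by rewrite expgMn ?dp ?mulg1 //; apply: (centsP abA).
    move=> b Bb Eb; case/imsetP: out; exists (b0^-1 * b).
      have Bb' : b0^-1 * b \in B by rewrite groupM ?groupV.
      rewrite !inE Bb' sB // andbT /=; apply/eqP/phi1; rewrite ?groupX //.
      rewrite (hom_X _ phiM) // phiM ?groupV // (hom_V phiM) // Eb Eb0.
      by rewrite mulKg.
    by rewrite phiM ?groupV // (hom_V phiM) // Eb Eb0 mulKg.
  have [psi [psiM psiA psiE]] := extend_hom abA sBA Ax B'x Bxp phiM phiA Ay yp.
  have psiB u : u \in B -> psi u = phi u.
    by move=> Bu; have := psiE u 0 Bu; rewrite !expg0 !mulg1.
  exists psi; split=> //.
  - by rewrite (subset_trans sCB) ?joing_subl.
  - by move=> u Cu; rewrite phia // psiB // (subsetP sCB).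
  move=> _ /xiP[b Bb [i ->]] => e1.
  (* Otherwise y would be a product of powers of y^i and y^p, both in phi (B). *)
  suffices p_i : p %| i.
    have Bbx : b * x ^+ i \in B.
      by rewrite groupM // -(divnK p_i) mulnC expgM groupX.
    by apply: phi1; rewrite // -psiB.
  apply: contraT => p'i; exfalso.
  have i_gt0 : 0 < i by rewrite lt0n; apply: contraNneq p'i => ->; apply: dvdn0.
  have [k l Ekl _] := egcdnP p i_gt0.
  have co : gcdn i p = 1%N by apply/eqP; rewrite gcdnC -/(coprime p i) prime_coprime.
  rewrite co addn1 in Ekl.
  have yi : y ^+ i = phi b^-1.
    by rewrite (hom_V phiM) //; apply: (mulgI (phi b)); rewrite -psiE // e1 mulgV.
  apply: (phi'y ((x ^+ p)^-1 ^+ l * b^-1 ^+ k)); first by rewrite groupM ?groupX ?groupV.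
  rewrite phiM ?(hom_X _ phiM) ?groupX ?groupV // (hom_V phiM) // -yi -expgM mulnC Ekl.
  by rewrite expgSr mulnC expgM yp expVgn mulKg.
have [|psi [_ psiM psia psiA psi1]] := @extension_induction A C Inv sCA step a.
- split=> // [u v Cu Cv|u Cu|u Cu]; first exact: AutM Aa _ _.
    by apply: (subsetP sCA); apply: Aut_closed.
  by move=> au1; apply: (@perm_inj _ a); rewrite au1 (Aut_1 Aa).
have [b Ab Eb] := Aut_of_fun psiM psiA psi1.
by exists b => // u Cu; rewrite psia // Eb // (subsetP sCA).
Qed.

End Extensions.

(** * Automorphisms of abelian groups without gaps *)

Section AutLowAcyclic.

Local Open Scope group_scope.

Variable p : nat.

Lemma eq_low_acyclic (rT : finGroupType) (G H : {group rT}) :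
  G :=: H -> low_acyclic p G -> low_acyclic p H.
Proof. by move/group_inj->. Qed.

Variable gT : finGroupType.
Hypotheses (p_pr : prime p) (p_gt3 : 3 < p).
Implicit Types (A B C D L : {group gT}) (e u x y : gT).

(* Take D1 maximal among the P-stable proper subgroups containing D :&: C.  As P
   is a p-group it fixes a coset of D1 in D other than D1, which together with D1
   generates D. *)
Lemma stable_hyperplane A C D (P : {group {perm gT}}) :
    abelian A -> D \subset A -> {in D, forall x, x ^+ p = 1} -> ~~ (D \subset C) ->
    p.-group P -> P \subset rel_aut A C D ->
  exists (D1 : {group gT}) (x : gT), [/\ D :&: C \subset D1, D1 \subset D,
    x \in D :\: D1, {in P & D1, forall (a : {perm gT}) u, a u \in D1} &
    {in D, forall u, exists i, u * x ^- i \in D1}].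
Proof.
move=> abA sDA Dp nsDC pP sPN.
have PN a : a \in P -> a \in rel_aut A C D := subsetP sPN a.
pose stable (H : {group gT}) :=
  [&& D :&: C \subset H, H \proper D & [forall a in P, forall u in H, a u \in H]].
have [|D1 /maxgroupP[/and3P[sD0 prD1 /forall_inP stD1] maxD1] _] :=
  @maxgroup_exists _ stable (D :&: C)%G.
  rewrite /stable subxx /= properEneq subsetIl andbT; apply/andP; split.
    by apply: contraNneq nsDC => <-; apply: subsetIr.
  apply/forall_inP=> a Pa; apply/forall_inP=> u DCu.
  have [_ Ca _] := rel_autP _ _ _ _ (PN a Pa); rewrite Ca //.
  by case/setIP: DCu.
have sD1D := proper_sub prD1.
have stab a u : a \in P -> u \in D1 -> a u \in D1 by move=> Pa; apply: (forall_inP (stD1 a Pa)).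
have sD1A := subset_trans sD1D sDA.
have pD : p.-group D.
  apply/pgroupP=> q q_pr /(Cauchy q_pr)[x Dx ox].
  have : #[x] %| p by rewrite order_dvdn Dp.
  by rewrite ox inE -dvdn_prime2.
have imD a x : a \in P -> x \in D -> a @: (D1 :* x) = D1 :* a x.
  move=> Pa Dx; have [Aa _ _] := rel_autP _ _ _ _ (PN a Pa).
  apply/eqP; rewrite eqEcard card_imset ?card_rcoset ?leqnn ?andbT; last exact: perm_inj.
  apply/subsetP=> _ /imsetP[_ /rcosetP[d Dd ->] ->].
  rewrite (AutM Aa) ?(subsetP sD1A d Dd) ?(subsetP sDA x Dx) // mem_rcoset mulgK.
  exact: stab.
have Da a x : a \in P -> x \in D -> a x \in D.
  move=> Pa Dx; have [Aa _ dD] := rel_autP _ _ _ _ (PN a Pa).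
  by rewrite -(displacementK a x) groupM ?dD ?(subsetP sDA).
have actP : [acts P, on rcosets D1 D | 'P^*].
  apply/subsetP=> a Pa; rewrite !inE; apply/subsetP=> _ /rcosetsP[x Dx ->].
  by rewrite inE /= /setact /= imD // mem_rcosets (subsetP (mulG_subr _ _)) // Da.
have p_dv : p %| #|rcosets D1 D|.
  have: p.-nat #|D : D1| by apply: pnat_dvd pD; apply: dvdn_indexg.
  case/p_natP=> [[|n]]; last by rewrite /indexg => ->; rewrite expnS dvdn_mulr.
  by move/eqP; rewrite indexg_eq1 (negPf (proper_subn prD1)).
have FixD1 : D1 :* 1 \in 'Fix_(rcosets D1 D | 'P^*)(P).
  rewrite inE mem_rcosets (subsetP (mulG_subr _ _)) //=.
  apply/afixP=> a Pa; rewrite /= /setact imD //.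
  by have [Aa _ _] := rel_autP _ _ _ _ (PN a Pa); rewrite (Aut_1 Aa).
(* The number of fixed cosets is |D : D1| = 0 modulo p, and D1 is one of them. *)
have /subsetPn[Dx] : ~~ ('Fix_(rcosets D1 D | 'P^*)(P) \subset [set D1 :* 1]).
  apply/negP=> sFix; have := pgroup_fix_mod pP actP.
  have -> : 'Fix_(rcosets D1 D | 'P^*)(P) = [set D1 :* 1].
    by apply/eqP; rewrite eqEsubset sFix sub1set.
  rewrite cards1 (eqP p_dv) => /eqP.
  by rewrite modn_small ?prime_gt1.
case/setIP=> /rcosetsP[x Dx0 ->{Dx}] /afixP fixx; rewrite inE => neqD1.
have D1'x : x \notin D1 by apply: contra neqD1 => D1x; rewrite mulg1 rcoset_id.
exists D1, x; split=> //; first by rewrite inE D1'x.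
have xiP u := @abelian_joing_cycleP _ A D1 x u abA sD1A (subsetP sDA x Dx0).
have ax a : a \in P -> a x \in D1 :* x.
  move=> Pa; have := fixx a Pa; rewrite /= /setact imD // => <-.
  exact: rcoset_refl.
pose H := (D1 <*> <[x]>)%G.
have sHD : H \subset D by rewrite join_subG sD1D cycle_subG.
have defD : H :=: D.
  (* D1<x> is stable and larger than D1; were it proper in D, maximality would be violated. *)
  apply/eqP; apply: contraTT (D1'x) => neqHD; rewrite negbK.
  have sD1H : D1 \subset H by apply: joing_subl.
  rewrite -(maxD1 H _ sD1H); last first.
    rewrite /stable (subset_trans sD0) //= properEneq neqHD sHD /=.
    apply/forall_inP=> a Pa; apply/forall_inP=> _ /xiP[b D1b [i ->]].
    have [Aa _ _] := rel_autP _ _ _ _ (PN a Pa).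
    have Ax := subsetP sDA x Dx0.
    rewrite (AutM Aa) ?groupX ?(subsetP sD1A _ D1b) // (AutX _ Aa) //.
    have /rcosetP[d D1d ->] := ax a Pa.
    have Hx : x \in H by apply: (subsetP (joing_subr D1 _)); apply: cycle_id.
    by rewrite groupM ?groupX ?groupM // (subsetP sD1H) ?stab.
  by apply: (subsetP (joing_subr D1 _)); apply: cycle_id.
move=> u; rewrite -defD => /xiP[b D1b [i ->]].
by exists i; rewrite mulgK.
Qed.

(** Induction on |D|. If D1 lies in C, the rank-one case applies. Otherwise put C' = C D1: since D
    :&: C' = D1, the kernel N(A, C', D) is of rank one, and the image N(C', C, D1) is covered by
    induction. *)
Theorem rel_aut_low_acyclic A C D : abelian A -> C \subset A -> D \subset A ->
  {in A, forall x, x ^+ p \in C} -> {in D, forall x, x ^+ p = 1} ->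
  ~~ (D \subset C) -> low_acyclic p (rel_aut A C D).
Proof.
have [n] := ubnP #|D|; elim: n A C D => // n IHn A C D; rewrite ltnS => le_n.
move=> abA sCA sDA Cp Dp nsDC.
set N := rel_aut A C D.
have [P sylP] := Sylow_exists p N; have [sPN pP _] := and3P sylP.
have [D1 [x [sD0 sD1D /setDP[Dx D1'x] stab span]]] :=
  stable_hyperplane abA sDA Dp nsDC pP sPN.
have C'x : x \notin C.
  by apply: contra D1'x => Cx; apply: (subsetP sD0); rewrite inE Dx.
have [sD1C | nsD1C] := boolP (D1 \subset C).
  apply: (rank_one_rel_aut p_pr p_gt3 abA sCA sDA Cp Dp Dx C'x) => u Du.
  by have [i /(subsetP sD1C)] := span u Du; exists i.
have [C' defC'] : exists C' : {group gT}, C' :=: C <*> D1 by exists (C <*> D1)%G.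
have sCC' : C \subset C' by rewrite defC' joing_subl.
have sD1C' : D1 \subset C' by rewrite defC' joing_subr.
have sD1A := subset_trans sD1D sDA.
have sC'A : C' \subset A by rewrite defC' join_subG sCA.
have C'P u : u \in C' -> exists2 v, v \in C & exists2 w, w \in D1 & u = v * w.
  rewrite defC' cent_joinEl; last by rewrite (subset_trans sCA) // (subset_trans abA) // centS.
  by case/mulsgP=> v w Cv D1w ->; exists v => //; exists w.
have DC' u : u \in D -> u \in C' -> u \in D1.
  move=> Du /C'P[v Cv [w D1w Eu]]; rewrite Eu groupM //.
  apply: (subsetP sD0); rewrite inE Cv andbT.
  by rewrite -(mulgK w v) -Eu groupM ?groupV // (subsetP sD1D).
have C''x : x \notin C' by apply: contra D1'x; apply: DC'.
have aK : low_acyclic p (rel_aut A C' D).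
  apply: (rank_one_rel_aut p_pr p_gt3 abA sC'A sDA _ Dp Dx C''x).
    by move=> u Au; apply: (subsetP sCC'); apply: Cp.
  by move=> u Du; have [i /(subsetP sD1C')] := span u Du; exists i.
have aQ : low_acyclic p (rel_aut C' C D1).
  apply: IHn => //.
  - apply: leq_trans le_n; apply/proper_card/properP; split=> //; first by exists x.
  - exact: abelianS sC'A abA.
  - by move=> u C'u; apply: Cp; apply: (subsetP sC'A).
  by move=> u D1u; apply: Dp; apply: (subsetP sD1D).
pose Q := (N :&: 'N(C' | 'P))%G.
have nP (a : {perm gT}) : reflect {in C', forall u, a u \in C'} (a \in 'N(C' | 'P)).
  apply: (iffP idP) => [/astabsP Na u C'u|Na]; first by rewrite -[a u]/(aperm u a) Na.
  by rewrite !inE; apply/subsetP=> u C'u; rewrite inE; apply: Na.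
(* The stabilizer Q of C' contains the Sylow subgroup P, so its index is prime to p. *)
apply: (low_acyclic_coprime_index p_pr (subsetIl N 'N(C' | 'P)) _).
  have sPQ : P \subset Q.
    rewrite subsetI sPN; apply/subsetP=> a Pa; apply/nP=> u /C'P[v Cv [w D1w ->]].
    have [Aa Ca _] := rel_autP _ _ _ _ (subsetP sPN a Pa).
    rewrite (AutM Aa) ?(subsetP sCA v Cv) ?(subsetP sD1A w D1w) // Ca //.
    by rewrite groupM ?(subsetP sCC' v Cv) // (subsetP sD1C') ?stab.
  have: #|N : Q| %| #|N : P| by apply: indexgS.
  by move/coprime_dvdr; apply; have [_ _] := and3P sylP; rewrite p'natE // -prime_coprime.
apply: (low_acyclic_extension p_pr (f := restr_perm_morphism C') (subsetIr _ _)).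
  apply: eq_low_acyclic aK; apply/esym/setP=> a /=.
  rewrite inE ker_restr_perm; apply/andP/idP=> [[/setIP[/rel_autP[Aa Ca Da] _] /astabP fixa]|].
    by apply/rel_autP; split.
  case/rel_autP=> Aa C'a Da; split; last by apply/astabP.
  rewrite inE; apply/andP; split; last by apply/nP=> u C'u; rewrite C'a.
  by apply/rel_autP; split=> // u Cu; rewrite C'a ?(subsetP sCC').
apply: eq_low_acyclic aQ; apply/esym/setP=> b /=.
apply/morphimP/idP=> [[a _ /setIP[/rel_autP[Aa Ca Da] na] ->]|].
  apply/rel_autP; split=> [|u Cu|u C'u] /=.
  - exact: (Aut_restr_perm sC'A Aa).
  - by rewrite restr_permE ?(subsetP sCC') // Ca.
  rewrite displacementE restr_permE // -displacementE DC' ?Da ?(subsetP sC'A) //.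
  by rewrite displacementE groupM ?groupV //; apply: (nP _ na).
(* Restriction is onto: an element of N(C', C, D1) extends to N(A, C, D1), a subgroup of N. *)
move=> Nb; have [a Na eq_ab] := rel_aut_extend p_pr abA sCC' sC'A Cp sD1C' Nb.
have [Ab _ _] := rel_autP _ _ _ _ Nb.
have na : a \in 'N(C' | 'P) by apply/nP=> u C'u; rewrite -eq_ab // Aut_closed.
have sN : rel_aut A C D1 \subset N by apply: rel_autS.
exists a => //; first by rewrite inE (subsetP sN).
have [Aa _ _] := rel_autP _ _ _ _ Na.
apply: (eq_Aut Ab (Aut_restr_perm sC'A Aa)) => u C'u.
by rewrite restr_permE // eq_ab.
Qed.

(** For an abelian p-group: the n-th Ulm invariant is nonzero whenever p^n A is. The element p^n y
    is p-torsion and not in p^(n+1) A, so y witnesses a cyclic summand of order p^(n+1). *)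
Definition gapless (A : {set gT}) := forall n,
  (exists2 x, x \in A & x ^+ (p ^ n) != 1) ->
  exists2 y, y \in A & y ^+ (p ^ n.+1) = 1 /\
    {in A, forall x, x ^+ (p ^ n.+1) <> y ^+ (p ^ n)}.

Theorem Aut_low_acyclic A : abelian A -> gapless A -> low_acyclic p [Aut A].
Proof.
have [n] := ubnP #|A|; elim: n A => // n IHn A; rewrite ltnS => le_n abA gapA.
have [A1 | ntA] := eqVneq A 1%G.
  by apply: eq_low_acyclic (low_acyclic1 p_pr _); rewrite /= A1 Aut1.
have powM : {in A &, {morph (fun x => x ^+ p) : x y / x * y}}.
  by move=> x y Ax Ay /=; rewrite expgMn //; apply: (centsP abA).
pose pw := Morphism powM.
pose C := (pw @* A)%G; pose D := ('ker pw)%G.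
have CP x : reflect (exists2 y, y \in A & x = y ^+ p) (x \in C).
  by apply: (iffP morphimP) => [[y _ Ay ->]|[y Ay ->]]; exists y.
have DP x : reflect (x \in A /\ x ^+ p = 1) (x \in D).
  by apply: (iffP idP) => [Dx|[Ax xp]]; [split; [case/morphpreP: Dx | exact: mker Dx] | apply/kerP].
have sCA : C \subset A by apply/subsetP=> _ /CP[y Ay ->]; apply: groupX.
have sDA : D \subset A by apply: subsetIl.
have Cp : {in A, forall x, x ^+ p \in C} by move=> x Ax; apply/CP; exists x.
(* At n = 0 gaplessness gives an element of A[p] outside pA; this is the condition for the kernel,
   and it makes C smaller than A. *)
have [y Ay [yp outy]] : exists2 y, y \in A & y ^+ (p ^ 1) = 1 /\
    {in A, forall x, x ^+ (p ^ 1) <> y ^+ (p ^ 0)}.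
  apply: gapA; have [x Ax ntx] := trivgPn _ ntA.
  by exists x; rewrite // expn0 expg1.
rewrite expn1 in yp outy; rewrite expn0 expg1 in outy.
have Dy : y \in D by apply/DP.
have C'y : y \notin C by apply/CP=> -[x Ax] /esym; apply: outy.
have aK : low_acyclic p (rel_aut A C D).
  apply: rel_aut_low_acyclic => //; first by move=> x /DP[].
  by apply/subsetPn; exists y.
have aC : low_acyclic p [Aut C].
  apply: IHn.
  - apply: leq_trans le_n; apply/proper_card/properP; split=> //; by exists y.
  - exact: abelianS sCA abA.
  (* Gaplessness of pA at m is that of A at m + 1. *)
  move=> m [_ /CP[x Ax ->]]; rewrite -expgM -expnS => ntx.
  have [|z Az [zp outz]] := gapA m.+1; first by exists x.
  exists (z ^+ p); first exact: Cp.
  rewrite -!expgM -!expnS; split=> // _ /CP[u Au ->].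
  by rewrite -expgM -expnS; apply: outz.
have nP (a : {perm gT}) : reflect {in C, forall u, a u \in C} (a \in 'N(C | 'P)).
  apply: (iffP idP) => [/astabsP Na u Cu|Na]; first by rewrite -[a u]/(aperm u a) Na.
  by rewrite !inE; apply/subsetP=> u Cu; rewrite inE; apply: Na.
have sAN : Aut A \subset 'N(C | 'P).
  apply/subsetP=> a Aa; apply/nP=> _ /CP[u Au ->]; rewrite (AutX _ Aa) // Cp //.
  exact: Aut_closed.
apply: (low_acyclic_extension p_pr (f := restr_perm_morphism C) sAN).
  apply: eq_low_acyclic aK; apply/esym/setP=> a /=.
  rewrite inE ker_restr_perm; apply/andP/idP=> [[Aa /astabP fixa]|/rel_autP[Aa Ca _]].
    apply/rel_autP; split=> // u Au; apply/DP; split; first exact: displacement_closed.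
    by rewrite -(displacementX abA) //; apply/displacement_fix/fixa/Cp.
  by split=> //; apply/astabP.
apply: eq_low_acyclic aC; apply/esym/setP=> b /=.
apply/morphimP/idP=> [[a _ Aa ->]|Ab]; first exact: (Aut_restr_perm sCA Aa).
have [a Aa eq_ab] := Aut_powers_extend p_pr abA sCA CP Ab.
have na := subsetP sAN a Aa.
exists a => //; apply: (eq_Aut Ab (Aut_restr_perm sCA Aa)) => u Cu.
by rewrite restr_permE // eq_ab.
Qed.

End AutLowAcyclic.

(** * Cochains of low degree *)

Section Cochains.

Local Open Scope ring_scope.
Local Open Scope group_scope.

Variables (gT : finGroupType) (G : {group gT}) (R : finNzRingType).
Local Notation T := (subg_of G).

Lemma cohomology_trivP n :
  cohomology G R n = 1%G <-> cocycles G R n \subset coboundaries G R n.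
Proof.
have nB : cocycles G R n \subset 'N(coboundaries G R n).
  apply: subset_trans (subsetT _) _; apply/cents_norm/centsP=> f1 _ f2 _.
  by rewrite /commute !cochainM addrC.
rewrite -quotient_sub1 //; split=> [/(congr1 (@gval _))/= ->|sB1]; first exact: subxx.
exact/trivGP.
Qed.

(** Explicit argument lists, on which faces can be computed. *)
Definition vec n (s : seq T) : {ffun 'I_n -> T} := [ffun i : 'I_n => nth 1 s i].

Lemma vec1E (g : {ffun 'I_1 -> T}) : g = vec 1 [:: g ord0].
Proof. by apply/ffunP=> i; rewrite ffunE (ord1 i). Qed.

Lemma vec2E (g : {ffun 'I_2 -> T}) : g = vec 2 [:: g ord0; g ord_max].
Proof.
apply/ffunP=> i; rewrite ffunE; case: i => [[|[|//]] lti] /=; congr (g _); exact: val_inj.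
Qed.

Lemma vec3E (g : {ffun 'I_3 -> T}) : g = vec 3 [:: g ord0; g (inord 1); g ord_max].
Proof.
apply/ffunP=> i; rewrite ffunE.
by case: i => [[|[|[|//]]] lti] /=; congr (g _); apply: val_inj; rewrite /= ?inordK.
Qed.

Lemma face_vec n i (s s' : seq T) :
  (forall j, (j < n)%N -> nth 1 s' j =
    if (j.+1 < i)%N then nth 1 s j
    else if j.+1 == i then nth 1 s j * nth 1 s j.+1 else nth 1 s j.+1) ->
  face i (vec n.+1 s) = vec n s'.
Proof.
move=> Es'; apply/ffunP=> j; rewrite !ffunE Es' //=.
Qed.

Lemma coboundary1E (f : cochain G R 1) a b :
  coboundary f (vec 2 [:: a; b]) = (f (vec 1 [:: b]) - f (vec 1 [:: (a * b)%g]) + f (vec 1 [:: a]))%R.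
Proof.
rewrite ffunE !big_ord_recl big_ord0 /=.
rewrite (@face_vec 1 0 _ [:: b]); last by case.
rewrite (@face_vec 1 1 _ [:: a * b]); last by case.
rewrite (@face_vec 1 2 _ [:: a]); last by case.
by rewrite expr0 expr1 sqrrN expr1n !mul1r mulN1r addr0 addrA.
Qed.

Lemma coboundary2E (f : cochain G R 2) a b c :
  coboundary f (vec 3 [:: a; b; c]) =
    (f (vec 2 [:: b; c]) - f (vec 2 [:: (a * b)%g; c])
     + f (vec 2 [:: a; (b * c)%g]) - f (vec 2 [:: a; b]))%R.
Proof.
rewrite ffunE !big_ord_recl big_ord0 /=.
rewrite (@face_vec 2 0 _ [:: b; c]); last by case=> [|[]].
rewrite (@face_vec 2 1 _ [:: a * b; c]); last by case=> [|[]].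
rewrite (@face_vec 2 2 _ [:: a; b * c]); last by case=> [|[]].
rewrite (@face_vec 2 3 _ [:: a; b]); last by case=> [|[]].
by rewrite expr0 expr1 sqrrN expr1n !mul1r exprS sqrrN expr1n mulr1 !mulN1r addr0 !addrA.
Qed.

Lemma coboundary0E (f : cochain G R 0) : coboundary f = 0%R.
Proof.
apply/ffunP=> g; rewrite ffunE !big_ord_recl big_ord0 /= ffunE.
have -> : face 1 g = face 0 g by apply/ffunP=> -[].
by rewrite expr0 expr1 mul1r mulN1r addr0 subrr.
Qed.

Lemma cocyclesP n (f : cochain G R n) : reflect (coboundary f = 0%R) (f \in cocycles G R n).
Proof.
apply: (iffP idP) => [/mker ->|f0]; first exact: cochain1.
by apply/kerP; rewrite ?inE // f0 cochain1.
Qed.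

Lemma coboundariesP n (f : cochain G R n.+1) :
  reflect (exists h : cochain G R n, f = coboundary h) (f \in coboundaries G R n.+1).
Proof.
apply: (iffP morphimP) => [[h _ _ ->]|[h ->]]; first by exists h.
by exists h; rewrite ?inE.
Qed.

(** The action is trivial, so B^1 = 0 and H^1 is the group of homomorphisms. *)
Lemma cohomology1P :
  cohomology G R 1 = 1%G <->
  (forall F : T -> R, (forall a b, F (a * b)%g = (F a + F b)%R) -> forall a, F a = 0%R).
Proof.
rewrite cohomology_trivP; split=> [sZB F FM a|homs0].
  pose f : cochain G R 1 := [ffun g : {ffun 'I_1 -> T} => F (g ord0)].
  have: f \in cocycles G R 1.
    apply/cocyclesP/ffunP=> g; rewrite (vec2E g) coboundary1E !ffunE /= FM.
    by rewrite -addrA [(- _ + _)%R]addrC addrA [(F _ + F _)%R]addrC subrr.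
  move/(subsetP sZB)/coboundariesP=> [h]; rewrite coboundary0E => /ffunP/(_ (vec 1 [:: a])).
  by rewrite !ffunE.
apply/subsetP=> f /cocyclesP f0; apply/coboundariesP; exists 0%R; rewrite coboundary0E.
apply/ffunP=> g; rewrite ffunE (vec1E g); apply: (homs0 (fun a => f (vec 1 [:: a]))) => a b.
have /ffunP/(_ (vec 2 [:: a; b])) := f0; rewrite coboundary1E ffunE => e.
by apply/esym/eqP; rewrite -subr_eq0 -addrA addrC; apply/eqP.
Qed.

End Cochains.

(** * Cohomology and low acyclicity *)

Section CocycleExtension.

Local Open Scope ring_scope.
Local Open Scope group_scope.

Variables (T : finGroupType) (R : finComNzRingType).

Definition is_cocycle2 (f : T -> T -> R) : Prop :=
  forall a b c, (f b c + f a (b * c)%g = f (a * b)%g c + f a b)%R.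

(** The cocycle proof is a parameter of the type, so that the group law can be attached to the type
    itself. *)
Definition cocycle_ext (f : T -> T -> R) & is_cocycle2 f : Type := (R * T)%type.

Variables (f : T -> T -> R) (ff : is_cocycle2 f).
Local Notation E := (cocycle_ext ff).

HB.instance Definition _ := Finite.copy E (R * T)%type.

Definition cext_mul (x y : E) : E := ((x.1 + y.1 + f x.2 y.2)%R, x.2 * y.2).
(** For a cocycle that may not be normalised, the unit has first component -f (1, 1). *)
Definition cext_one : E := ((- f 1%g 1%g)%R, 1).
Definition cext_inv (x : E) : E := ((- x.1 - f (x.2^-1)%g x.2 - f 1%g 1%g)%R, x.2^-1).

Lemma cocycle1l a : f 1 a = f 1 1.
Proof. by have := ff 1 1 a; rewrite !mul1g => /addrI. Qed.

Lemma cocycle1r a : f a 1 = f 1 1.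
Proof. by have := ff a 1 1; rewrite !mulg1 addrC => /addrI. Qed.

Lemma cext_mulA : associative cext_mul.
Proof.
move=> [r a] [s b] [t c]; congr (_, _); rewrite /= ?mulgA //.
have e := ff a b c.
transitivity (r + s + t + (f b c + f a (b * c)%g))%R; first by ring.
by rewrite e; ring.
Qed.

Lemma cext_mul1 : left_id cext_one cext_mul.
Proof.
by move=> [r a]; congr (_, _); rewrite /= ?mul1g // cocycle1l; ring.
Qed.

Lemma cext_mulV : left_inverse cext_one cext_inv cext_mul.
Proof. by move=> [r a]; congr (_, _); rewrite /= ?mulVg //; ring. Qed.

HB.instance Definition _ := Finite_isGroup.Build E cext_mulA cext_mul1 cext_mulV.

Lemma cext_mulE (x y : E) : x * y = ((x.1 + y.1 + f x.2 y.2)%R, x.2 * y.2).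
Proof. by []. Qed.

End CocycleExtension.

(** * From splittings to vanishing cohomology, and from H^2 to H^1 *)

Section Bridge.

Local Open Scope ring_scope.
Local Open Scope group_scope.

Variables (p : nat) (gT : finGroupType) (G : {group gT}).
Hypothesis p_pr : prime p.
Local Notation T := (subg_of G).

(** A complement of the kernel in the extension defined by f contains exactly one pair (b g, g) for
    each g; its closure under products is the equation for b. *)
Lemma splits_cocycle (f : T -> T -> 'F_p) : low_acyclic p G -> is_cocycle2 f ->
  exists b : T -> 'F_p, forall x y, (f x y = b (x * y)%g - b x - b y)%R.
Proof.
move=> [_ splG] ff; pose E := cocycle_ext ff.
pose pi (x : E) : gT := sgval x.2.
have piM : {in [set: E] &, {morph pi : x y / x * y}} by move=> x y _ _; apply: morphM; rewrite inE.
pose phi := Morphism piM.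
have kP (x : E) : reflect (x.2 = 1) (x \in 'ker phi).
  apply: (iffP idP) => [/mker x1|x1]; last by apply/kerP; rewrite ?inE //= /pi x1.
  exact: val_inj.
have imphi : phi @* [set: E] = G.
  apply/setP=> x; apply/morphimP/idP=> [[y _ _ ->]|Gx]; first exact: subgP.
  by exists ((0%R, subg G x) : E); rewrite ?inE //= /pi subgK.
have cphi : 'ker phi \subset 'Z([set: E]).
  rewrite subsetI subsetT; apply/centsP=> -[r z] /kP /= -> [t y] _.
  by rewrite /commute !cext_mulE /= mul1g mulg1 (cocycle1l ff) (cocycle1r ff) [(r + t)%R]addrC.
have cardk : #|'ker phi| = p.
  have -> : 'ker phi = [set ((r, 1) : E) | r in 'F_p].
    apply/setP=> -[r z]; apply/kP/imsetP=> /= [->|[t _ [_ ->]] //]; by exists r.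
  by rewrite card_imset ?card_Fp // => r t [].
have /splitsP[K /complP[tiK defE]] := splG _ [set: E]%G phi imphi cphi cardk.
have exK g : exists r, ((r, g) : E) \in K.
  have: ((0%R, g) : E) \in 'ker phi * K by rewrite defE inE.
  case/mulsgP=> -[r z] [t y] /kP /= -> Kk /(congr1 snd) /= ->.
  by exists t; rewrite mul1g.
pose b g : 'F_p := xchoose (exK g).
have bK g : ((b g, g) : E) \in K := xchooseP (exK g).
have uniqK g r t : ((r, g) : E) \in K -> ((t, g) : E) \in K -> r = t.
  move=> Kr Kt.
  have : ((r, g) : E) * ((t, g) : E)^-1 \in 'ker phi :&: K.
    rewrite inE (groupM Kr (groupVr Kt)) andbT; apply/kP.
    by rewrite cext_mulE /= mulgV.
  rewrite tiK => /set1P/(canRL (mulgKV _)); rewrite mul1g => -[].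
  by [].
exists b => x y; have Kxy := groupM (bK x) (bK y).
by rewrite (uniqK _ _ _ (bK (x * y)) Kxy) /=; ring.
Qed.

(** A nonzero homomorphism to F_p is onto, so its kernel is normal of index p. *)
Lemma low_acyclic_cohomology1 : low_acyclic p G -> cohomology G 'F_p 1 = 1%G.
Proof.
move=> [noG _]; apply/cohomology1P=> F FM a.
pose phi x : ('F_p : finGroupType) := F (subg G x).
have phiM : {in G &, {morph phi : x y / (x * y)%g}}.
  by move=> x y Gx Gy; rewrite /phi morphM // FM.
pose f := Morphism phiM.
have nK : ('ker f)%G <| G := ker_normal f.
apply/eqP; apply: contraT => Fa; have /negP[] := noG _ nK.
have := card_morphim f G; rewrite setIid -/('ker f) => <-.
have im_dv : (#|f @* G| %| p)%N by have := cardSg (subsetT (f @* G)); rewrite cardsT card_Fp.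
apply/eqP/(prime_nt_dvdP p_pr) => //.
rewrite -trivg_card1; apply: contra Fa => /eqP im1.
have : f (sgval a) \in f @* G by rewrite mem_morphim ?subgP.
by rewrite im1 => /set1P; rewrite /= /phi sgvalK => ->.
Qed.

Lemma low_acyclic_cohomology2 : low_acyclic p G -> cohomology G 'F_p 2 = 1%G.
Proof.
move=> aG; apply/cohomology_trivP/subsetP=> f /cocyclesP f0.
pose c (x y : T) := f (vec 2 [:: x; y]).
have fc : is_cocycle2 c.
  move=> x y z; have /ffunP/(_ (vec 3 [:: x; y; z])) := f0; rewrite coboundary2E ffunE => e.
  by apply/eqP; rewrite -subr_eq0 -[X in _ == X]e /c; apply/eqP; ring.
have [b Eb] := splits_cocycle aG fc.
(* The sign: the coboundary of -b at (x, y) is -b y + b (x y) - b x. *)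
apply/coboundariesP; exists [ffun g : {ffun 'I_1 -> T} => - b (g ord0)]%R.
apply/ffunP=> g; rewrite (vec2E g) coboundary1E !ffunE /= -/(c _ _) Eb; ring.
Qed.

Local Open Scope nat_scope.

(* Bockstein: by induction on m a nonzero homomorphism to Z/p, represented by
   the values of L, lifts to Z/p^m, and this fails once p^m exceeds #[x]. *)
Lemma cohomology2_cohomology1 : cohomology G 'F_p 2 = 1%G -> cohomology G 'F_p 1 = 1%G.
Proof.
move=> /cohomology_trivP sZB; apply/cohomology1P=> F FM x; apply/eqP; apply: contraT => Fx.
have p_gt0 := prime_gt0 p_pr.
have natFp (m n : nat) : (m%:R = n%:R :> 'F_p)%R -> m = n %[mod p].
  by move=> e; rewrite -!val_Fp_nat // e.
have lift m : exists2 L : T -> nat,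
    (forall a b, L (a * b)%g = L a + L b %[mod p ^ m.+1]) & ~~ (p %| L x).
  elim: m => [|m [L LM Lx]].
    exists (fun a => F a : nat) => [a b|].
      by rewrite expn1 FM; apply: natFp; rewrite natrD !natr_Zp.
    by rewrite (dvdn_pcharf (pchar_Fp p_pr)) natr_Zp.
  set P := (p ^ m.+1)%N in LM.
  have P_gt0 : 0 < P by rewrite expn_gt0 p_gt0.
  (* k is the carry in the addition of the reduced values L0; its class in H^2 is the obstruction to
     lifting to Z/p^(m+2). *)
  pose L0 a := L a %% P.
  pose k a b := (L0 a + L0 b) %/ P.
  have kE a b : L0 a + L0 b = k a b * P + L0 (a * b)%g.
    by rewrite {1}(divn_eq (L0 a + L0 b) P) /L0 LM modnDm.
  have kM a b c : k b c + k a (b * c)%g = k (a * b)%g c + k a b.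
    apply/eqP; rewrite -(eqn_pmul2r P_gt0) !mulnDl; apply/eqP.
    have := kE a b; have := kE b c; have := kE a (b * c)%g; have := kE (a * b)%g c.
    rewrite mulgA; move: (L0 a) (L0 b) (L0 c) (L0 _) (L0 _) (L0 _) (k _ _ * P) (k _ _ * P).
    by move: (k b c * P) (k a b * P); lia.
  pose f : cochain G 'F_p 2 := [ffun g : {ffun 'I_2 -> T} => (k (g ord0) (g ord_max))%:R%R].
  have /(subsetP sZB)/coboundariesP[h fh] : f \in cocycles G 'F_p 2.
    apply/cocyclesP/ffunP=> g; rewrite (vec3E g) coboundary2E !ffunE /=.
    have /(congr1 (fun n => n%:R%R : 'F_p)) := kM (g ord0) (g (inord 1)) (g ord_max).
    rewrite !natrD => /eqP; rewrite -subr_eq0 => /eqP <-; ring.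
  pose be a := h (vec 1 [:: a]).
  have kbe a b : ((k a b)%:R = be b - be (a * b)%g + be a :> 'F_p)%R.
    by rewrite /be -coboundary1E -fh !ffunE.
  have be_le a : be a <= p by apply: ltnW; rewrite -[X in _ < X](Fp_cast p_pr) ltn_ord.
  (* [p - be a] represents -be a by a natural number; adding P times it cancels the carry. *)
  exists (fun a => L0 a + P * (p - be a)) => [a b|].
    have -> : L0 a + P * (p - be a) + (L0 b + P * (p - be b)) =
        L0 (a * b)%g + P * (k a b + (p - be a) + (p - be b)).
      by rewrite addnACA kE !mulnDr mulnC; lia.
    rewrite expnSr -/P; apply/eqP; rewrite eqn_modDl -!muln_modr; apply/eqP; congr (_ * _).
    apply: natFp; rewrite !natrD !natrB // !natr_Zp pchar_Fp_0 // kbe; ring.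
  have pP : p %| P by rewrite /P expnS dvdn_mulr.
  rewrite dvdn_addl; last by rewrite dvdn_mulr.
  by apply: contra Lx; rewrite (divn_eq (L x) P) => pL; rewrite dvdn_add // dvdn_mull.
(* The modulus p^(#[x] + 1) exceeds #[x], yet it would divide [#[x] * L x] with L x prime to p. *)
have [L LM Lx] := lift #[x].
set P := (p ^ _)%N in LM.
have L1 : L 1%g = 0 %[mod P].
  by have /eqP := LM 1%g 1%g; rewrite mulg1 -{1}[L 1%g]addn0 eqn_modDl => /eqP.
have LX n : L (x ^+ n)%g = n * L x %[mod P].
  elim: n => [|n IHn]; first by rewrite expg0 L1.
  by rewrite expgS LM -modnDmr IHn modnDmr mulSn.
have : P %| #[x] * L x by rewrite /dvdn -LX expg_order L1 mod0n.
have coP : coprime P (L x) by rewrite /P coprime_pexpl // prime_coprime.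
rewrite (Gauss_dvdl _ coP) => /(dvdn_leq (order_gt0 x)); rewrite leqNgt => /negP[].
apply: leq_trans (ltn_expl _ (prime_gt1 p_pr)) _.
by rewrite leq_pexp2l.
Qed.

End Bridge.

(** * Coordinates *)

Section Concrete.

Local Open Scope ring_scope.
Local Open Scope group_scope.
Local Open Scope nat_scope.

Variables (p k : nat) (lam rho : k.-tuple nat).
Hypothesis p_pr : prime p.
Hypothesis lam_gt0 : forall i : 'I_k, 0 < tnth lam i.
Local Notation A := (abelian_of p lam rho).
Local Notation l i := (tnth lam i).

Definition acoord (x : A) (i : 'I_k) (s : 'I_(tnth rho i)) : 'Z_(p ^ l i) := x i s.

Definition of_coords (c : forall i (s : 'I_(tnth rho i)), 'Z_(p ^ l i)) : A :=
  [ffun i => [ffun s => c i s]].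

Lemma of_coordsK c i s : acoord (of_coords c) s = c i s.
Proof. by rewrite /acoord !ffunE. Qed.

Lemma eq_coord (x y : A) : (forall i s, @acoord x i s = acoord y s) -> x = y.
Proof. by move=> e; apply/ffunP=> i; apply/ffunP=> s; apply: e. Qed.

Lemma coordM (x y : A) i s : @acoord (x * y)%g i s = (acoord x s + acoord y s)%R.
Proof. by rewrite /acoord !ffunE. Qed.

Lemma coord1 i s : @acoord 1%g i s = 0%R.
Proof. by rewrite /acoord !ffunE. Qed.

Lemma coordX (x : A) n i s : @acoord (x ^+ n)%g i s = (acoord x s *+ n)%R.
Proof.
elim: n => [|n IHn]; first by rewrite expg0 coord1.
by rewrite expgS coordM IHn mulrS.
Qed.

Lemma abelian_of_abelian : abelian [set: A].
Proof.
apply/centsP=> x _ y _; apply: eq_coord => i s.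
by rewrite !coordM addrC.
Qed.

Lemma natZ_eq (m a b : nat) : 1 < m -> (a%:R = b%:R :> 'Z_m)%R <-> a = b %[mod m].
Proof.
move=> m_gt1; split=> [/(congr1 val) /=|e]; first by rewrite !val_Zp_nat.
by apply: val_inj; rewrite /= !val_Zp_nat.
Qed.

Lemma natZ_eq0 (m a : nat) : 1 < m -> (a%:R = 0 :> 'Z_m)%R <-> m %| a.
Proof.
move=> m_gt1; have := natZ_eq a 0 m_gt1; rewrite mod0n => ->.
by split=> /eqP.
Qed.

Let expl_gt1 i : 1 < p ^ l i.
Proof. by rewrite -(exp1n (l i)) ltn_exp2r ?prime_gt1. Qed.

(** A basis vector; the type of s depends on i, so s and s0 are compared as natural numbers. *)
Definition ecoord i0 (s0 : 'I_(tnth rho i0)) : A :=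
  of_coords (fun i s => ((i == i0) && (s == s0 :> nat))%:R%R).

Lemma coord_ecoord i0 s0 i s :
  acoord (@ecoord i0 s0) s = (((i == i0) && (s == s0 :> nat))%:R : 'Z_(p ^ l i))%R.
Proof. exact: of_coordsK. Qed.

Lemma ecoord_order i0 s0 n : l i0 <= n -> (@ecoord i0 s0 ^+ (p ^ n) = 1)%g.
Proof.
move=> le_n; apply: eq_coord => i s; rewrite coordX coord_ecoord coord1.
rewrite -mulrnA; apply/natZ_eq0 => //; case: eqP => [ei|_] /=; last by rewrite mul0n.
by apply/dvdn_mull/dvdn_exp2l; rewrite ei.
Qed.

(** If p^n A is nonzero, some part exceeds n. The last such part is n + 1, since the next one is at
    most n and the step at most 1; y is a basis vector for it. *)
Lemma gapless_abelian_of (hrho : forall i : 'I_k, 0 < tnth rho i) :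
  (forall j, j < k -> nth 0 lam j - nth 0 lam j.+1 <= 1) ->
  gapless p [set: A].
Proof.
move=> gaps n [x _ xn].
have [i ln_i] : exists i : 'I_k, n < l i.
  apply/existsP; apply: contraR xn => /existsPn le_n; apply/eqP/eq_coord => i s.
  rewrite coordX coord1 -[acoord x s]natr_Zp -mulrnA; apply/natZ_eq0 => //.
  by rewrite dvdn_mull // dvdn_exp2l // leqNgt.
have [i0 li0] : exists i0 : 'I_k, l i0 = n.+1.
  have [m [m_lt m_n m1_n]] : exists m, [/\ m < k, n < nth 0 lam m & nth 0 lam m.+1 <= n].
    have ex_m : exists m, (m < k) && (n < nth 0 lam m).
      by exists i; rewrite ltn_ord /= -tnth_nth.
    have ub m : (m < k) && (n < nth 0 lam m) -> m <= k by case/andP=> /ltnW.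
    have [m /andP[m_lt m_n] max_m] := ex_maxnP ex_m ub.
    exists m; split=> //; rewrite leqNgt; apply/negP=> n_m1.
    (* When m + 1 = k, the default 0 of [nth] acts as lambda_(k+1). *)
    suffices m1_lt : m.+1 < k by have := max_m m.+1; rewrite m1_lt n_m1 ltnn => /(_ isT).
    rewrite ltn_neqAle m_lt andbT; apply: contraTneq n_m1 => ->.
    by rewrite nth_default ?size_tuple.
  exists (Ordinal m_lt); rewrite (tnth_nth 0) /=.
  by have := gaps m m_lt; lia.
pose s0 := Ordinal (hrho i0).
exists (ecoord s0); first by rewrite inE.
split=> [|y _]; first by apply: ecoord_order; rewrite li0.
(* At s0, modulo p^(n+1), the left side is 0 and the right side is p^n. *)
move/(congr1 (fun z : A => acoord z s0)); rewrite !coordX coord_ecoord !eqxx /=.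
rewrite -[acoord y s0]natr_Zp -!mulrnA => /natZ_eq -/(_ (expl_gt1 _)).
move: (nat_of_ord _) => c; rewrite li0 mul1n modnMl => /esym/eqP.
by rewrite -/(dvdn _ _) dvdn_Pexp2l ?prime_gt1 // ltnn.
Qed.

End Concrete.

(** * Gaps and the determinant modulo p^2 *)

Section FermatQuotient.

Local Open Scope ring_scope.
Local Open Scope group_scope.
Local Open Scope nat_scope.

Variable p : nat.
Hypothesis p_pr : prime p.

(** On integers prime to p this is a logarithm from the units modulo p^2 onto Z/p. *)
Definition fermat_quotient n := (n ^ p.-1 - 1) %/ p.
Local Notation q := fermat_quotient.

Lemma fermat_quotientE n : ~~ (p %| n) -> n ^ p.-1 = 1 + p * q n.
Proof.
move=> pn; have n_gt0 : 0 < n by rewrite lt0n; apply: contraNneq pn => ->.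
have e : n ^ p.-1 = 1 %[mod p].
  rewrite -(totient_prime p_pr); apply: Euler_exp_totient.
  by rewrite coprime_sym prime_coprime.
have n1_gt0 : 0 < n ^ p.-1 by rewrite expn_gt0 n_gt0.
have /divnK : p %| n ^ p.-1 - 1 by rewrite -eqn_mod_dvd // e.
by rewrite /q mulnC => ->; rewrite subnKC.
Qed.

(** (1 + p q(a)) (1 + p q(b)) = 1 + p (q(a) + q(b)) modulo p^2. *)
Lemma fermat_quotientM a b c : ~~ (p %| a) -> ~~ (p %| b) ->
  c = a * b %[mod p ^ 2] -> q c = q a + q b %[mod p].
Proof.
move=> pa pb e.
have p_gt0 := prime_gt0 p_pr.
have pc : ~~ (p %| c).
  have ep : c = a * b %[mod p].
    by rewrite -(@modn_dvdm (p ^ 2)) ?dvdn_exp // e modn_dvdm // dvdn_exp.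
  by rewrite /dvdn ep -/(dvdn _ _) Euclid_dvdM // negb_or pa.
have: c ^ p.-1 = (a * b) ^ p.-1 %[mod p ^ 2] by rewrite -modnXm e modnXm.
rewrite expnMn !fermat_quotientE //.
have -> : (1 + p * q a) * (1 + p * q b) = q a * q b * p ^ 2 + (1 + p * (q a + q b)) by ring.
rewrite modnMDl => /eqP; rewrite eqn_modDl expnS expn1 -!muln_modr eqn_pmul2l //.
by move/eqP.
Qed.

(** (1 + p)^(p-1) = 1 + p (p - 1) modulo p^2, so q(p + 1) = -1 modulo p. *)
Lemma fermat_quotient1p : ~~ (p %| q p.+1).
Proof.
have p_gt1 := prime_gt1 p_pr.
have e n : p.+1 ^ n = 1 + p * n %[mod p ^ 2].
  elim: n => [|n IHn]; first by rewrite muln0.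
  rewrite expnS -modnMmr IHn modnMmr.
  have -> : p.+1 * (1 + p * n) = n * p ^ 2 + (1 + p * n.+1) by ring.
  by rewrite modnMDl.
have := e p.-1; rewrite fermat_quotientE; last first.
  by rewrite -addn1 dvdn_addr // dvdn1 neq_ltn p_gt1 orbT.
move/eqP; rewrite eqn_modDl expnS expn1 -!muln_modr eqn_pmul2l ?prime_gt0 // => /eqP e1.
rewrite /dvdn e1 -/(dvdn _ _) gtnNdvd //; lia.
Qed.

End FermatQuotient.

(** * The determinant modulo p^2 of the block of large exponents *)

Section BlockDeterminant.

Local Open Scope ring_scope.
Local Open Scope group_scope.
Local Open Scope nat_scope.

Variables (p k : nat) (lam rho : k.-tuple nat) (thr : nat).
Hypothesis p_pr : prime p.
Hypothesis lam_gt0 : forall i : 'I_k, 0 < tnth lam i.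
Hypothesis thr_gt1 : 1 < thr.
Hypothesis gap : forall i : 'I_k, tnth lam i < thr -> (tnth lam i).+2 <= thr.
Local Notation A := (abelian_of p lam rho).
Local Notation l i := (tnth lam i).
Local Notation S := {i : 'I_k & 'I_(tnth rho i)}.

Let expl_gt1 i : 1 < p ^ l i.
Proof. by rewrite -(exp1n (l i)) ltn_exp2r ?prime_gt1. Qed.

Let p2_gt1 : 1 < p ^ 2.
Proof. by rewrite -(exp1n 2) ltn_exp2r ?prime_gt1. Qed.

Definition ncoord (x : A) (t : S) : nat := acoord x (tagged t).
Definition bvec (t : S) : A := ecoord p lam (tagged t).

Lemma ncoord_bvec t t' : ncoord (bvec t') t = (t == t').
Proof.
rewrite /ncoord coord_ecoord (_ : _ && _ = (t == t')).
  by rewrite val_Zp_nat // modn_small //; case: eqP => _ //; apply: ltnW.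
apply/andP/eqP => [[/eqP]|->]; last by rewrite !eqxx.
case: t t' => [i s] [i' s'] /= e; subst i; move=> /eqP/val_inj ->.
by [].
Qed.

Lemma coord_prod (I : finType) (F : I -> A) (t : S) :
  acoord (\prod_i F i)%g (tagged t) = (\sum_i acoord (F i) (tagged t))%R.
Proof.
apply: (big_morph (fun x : A => acoord x (tagged t))) => [x y|]; first exact: coordM.
exact: coord1.
Qed.

Lemma sum_bvec (x : A) : x = (\prod_(t : S) bvec t ^+ ncoord x t)%g.
Proof.
apply: eq_coord => i s; rewrite (coord_prod _ (Tagged _ s)) /=.
rewrite (bigD1 (Tagged (fun i => 'I_(tnth rho i)) s)) //= big1 ?addr0 => [|t neq_t].
  rewrite coordX -[acoord (bvec _) s]natr_Zp.
  rewrite -[nat_of_ord (acoord (bvec _) s)]/(ncoord _ (Tagged _ s)) ncoord_bvec eqxx.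
  by rewrite /ncoord /= natr_Zp.
rewrite coordX -[acoord (bvec _) s]natr_Zp.
by rewrite -[nat_of_ord (acoord (bvec _) s)]/(ncoord _ (Tagged _ s)) ncoord_bvec eq_sym (negPf neq_t) mul0rn.
Qed.

Lemma ncoord_aut (h : {perm A}) (x : A) t : h \in Aut [set: A] ->
  ncoord (h x) t = \sum_(u : S) ncoord x u * ncoord (h (bvec u)) t %[mod p ^ l (tag t)].
Proof.
move=> Ah; apply/natZ_eq => //.
have hM : {morph h : x y / (x * y)%g} by move=> y z; apply: (AutM Ah); rewrite inE.
have h1 : h 1%g = 1%g := Aut_1 Ah.
rewrite /ncoord natr_Zp {1}(sum_bvec x) (big_morph h hM h1) coord_prod natr_sum.
apply: eq_bigr => u _; rewrite (AutX _ Ah) ?inE // coordX natrM natr_Zp.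
by rewrite mulr_natl.
Qed.

Definition high : pred S := fun t => thr <= l (tag t).
Local Notation Z2 := 'Z_(p ^ 2).

(** Reduction modulo p^2 makes sense because all exponents in the block are at least [thr], hence at
    least 2. *)
Definition high_block (g : {perm A}) : 'M[Z2]_#|high| :=
  \matrix_(a, b) (ncoord (g (bvec (enum_val b))) (enum_val a))%:R%R.

(* The order of [bvec t] is p ^ l (tag t), and l (tag a) is larger by at least 2. *)
Lemma low_high_coord (h : {perm A}) t a : h \in Aut [set: A] -> ~~ high t -> high a ->
  p ^ 2 %| ncoord (h (bvec t)) a.
Proof.
move=> Ah; rewrite /high -ltnNge => /gap lt_t le_a.
have := congr1 (fun z : A => acoord z (tagged a)) (congr1 h (ecoord_order p_pr lam_gt0 (tagged t) (leqnn _))).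
rewrite (AutX _ Ah) ?inE // (Aut_1 Ah) coord1 coordX -[acoord _ _]natr_Zp -mulrnA.
move/(natZ_eq0 _ (expl_gt1 _)); rewrite -/(ncoord _ _) => dv.
have e : l (tag a) = (l (tag a) - l (tag t)) + l (tag t) by rewrite subnK //; lia.
move: dv; rewrite {1}e expnD dvdn_pmul2r ?expn_gt0 ?prime_gt0 //; apply: dvdn_trans.
by rewrite dvdn_exp2l //; lia.
Qed.

(** A low intermediate index contributes a multiple of p^2 to an entry of the product. The order is
    reversed because [g * h] applies g first. *)
Lemma high_blockM (g h : {perm A}) : g \in Aut [set: A] -> h \in Aut [set: A] ->
  high_block (g * h)%g = (high_block h *m high_block g)%R.
Proof.
move=> Ag Ah; apply/matrixP=> a b; rewrite !mxE permM.
have high_a : high (enum_val a) := enum_valP a.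
set t := enum_val a in high_a *; set x := g _.
have dv : p ^ 2 %| p ^ l (tag t) by rewrite dvdn_exp2l // (leq_trans thr_gt1).
have -> : ((ncoord (h x) t)%:R = (\sum_(u : S) ncoord x u * ncoord (h (bvec u)) t)%:R :> Z2)%R.
  by apply/natZ_eq => //; rewrite -(modn_dvdm _ dv) ncoord_aut // modn_dvdm.
rewrite natr_sum (bigID high) /= [X in (_ + X)%R]big1 ?addr0 => [|u low_u]; last first.
  by apply/natZ_eq0 => //; apply/dvdn_mull/low_high_coord.
rewrite (big_enum_val _ (A := high)) /=; apply: eq_bigr => u _.
by rewrite !mxE natrM mulrC.
Qed.

Lemma high_block1 : high_block 1%g = 1%:M%R.
Proof.
apply/matrixP=> a b; rewrite !mxE perm1 ncoord_bvec.
by rewrite (inj_eq enum_val_inj).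
Qed.

Definition block_det (g : {perm A}) : nat := (\det (high_block g))%R.

Lemma block_detM (g h : {perm A}) : g \in Aut [set: A] -> h \in Aut [set: A] ->
  block_det (g * h)%g = block_det g * block_det h %[mod p ^ 2].
Proof.
move=> Ag Ah; apply/natZ_eq => //.
by rewrite natrM /block_det !natr_Zp high_blockM // det_mulmx mulrC.
Qed.

Lemma block_det1 : block_det 1%g = 1.
Proof. by rewrite /block_det high_block1 det1 /= modn_small // Zp_cast. Qed.

Lemma block_det_unit (g : {perm A}) : g \in Aut [set: A] -> ~~ (p %| block_det g).
Proof.
move=> Ag; apply/negP=> pg; have := block_detM Ag (groupVr Ag).
rewrite mulgV block_det1 => /(congr1 (modn^~ p)); rewrite !modn_dvdm ?dvdn_exp //.
by rewrite modn_small ?prime_gt1 // => /eqP; rewrite eq_sym => /eqP e; have := dvdn_mulr (block_det g^-1) pg; rewrite /dvdn e.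
Qed.

(** Multiplying the coordinate t0 by the unit p + 1 gives a diagonal block. *)
Lemma stretch_aut (t0 : S) : high t0 ->
  exists2 g : {perm A}, g \in Aut [set: A] & block_det g = p.+1.
Proof.
move=> high0; pose w (t : S) := if t == t0 then p.+1 else 1.
pose f (x : A) : A := of_coords (fun i s => acoord x s * (w (Tagged _ s))%:R)%R.
have fE x i s : acoord (f x) s = (acoord x s * (w (Tagged (fun i => 'I_(tnth rho i)) s))%:R :> 'Z_(p ^ l i))%R.
  exact: of_coordsK.
have [|||g Ag Eg] := @Aut_of_fun _ [set: A]%G f.
- by move=> x y _ _; apply: eq_coord => i s; rewrite coordM !fE coordM mulrDl.
- by move=> x _; rewrite inE.
- move=> x _ fx1; apply: eq_coord => i s; rewrite coord1.
  have := congr1 (fun z : A => acoord z s) fx1; rewrite fE coord1.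
  have U : ((w (Tagged (fun i => 'I_(tnth rho i)) s))%:R : 'Z_(p ^ l i))%R \is a GRing.unit.
    rewrite unitZpE // coprime_pexpl //; rewrite /w; case: eqP => _; last exact: coprimen1.
    exact: coprimenS.
  by move/(canRL (mulrK U)); rewrite mul0r.
exists g => //.
rewrite /block_det.
pose D : 'rV[Z2]_#|high| := (\row_(a < #|high|) (w (@enum_val _ high a))%:R)%R.
have -> : high_block g = diag_mx D.
  apply/matrixP=> a b; rewrite !mxE Eg ?inE //.
  set t := enum_val a; have high_t : high t := enum_valP a.
  have dv : p ^ 2 %| p ^ l (tag t) by rewrite dvdn_exp2l // (leq_trans thr_gt1).
  have -> : ((ncoord (f (bvec (enum_val b))) t)%:R = (w t * (a == b))%:R :> Z2)%R.
    apply/natZ_eq => //; rewrite -(modn_dvdm _ dv) -[RHS](modn_dvdm _ dv); congr (_ %% _).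
    apply/natZ_eq => //; rewrite natr_Zp /f fE natrM mulrC; congr (_ * _)%R.
    rewrite -[LHS]natr_Zp -/(ncoord _ t) ncoord_bvec.
    by rewrite (inj_eq enum_val_inj).
  by rewrite natrM mulr_natr.
rewrite det_diag.
pose a0 : 'I_#|high| := enum_rank_in high0 t0.
have Ea0 : enum_val a0 = t0 by apply: enum_rankK_in.
have -> : (\prod_i D 0 i = p.+1%:R :> Z2)%R.
  rewrite (bigD1 a0) // big1 => [|a neq_a].
    by apply: etrans (GRing.mulr1 _) _; rewrite mxE Ea0 /w eqxx.
  by rewrite mxE /w -Ea0 (inj_eq enum_val_inj) (negPf neq_a).
rewrite val_Zp_nat // modn_small //.
by rewrite expnS expn1; have := prime_gt1 p_pr; nia.
Qed.

(** The Fermat quotient of the block determinant is a homomorphism to F_p, nonzero on the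
    automorphism stretching t0. *)
Theorem block_det_hom (t0 : S) : high t0 ->
  cohomology (Aut [set: A]) 'F_p 1 != 1%G.
Proof.
move=> high0; apply/eqP=> /cohomology1P homs0.
pose F (a : subg_of [Aut [set: A]]) : 'F_p := (fermat_quotient p (block_det (sgval a)))%:R%R.
have [g Ag Eg] := stretch_aut high0.
have /homs0/(_ (subg _ g)) : forall a b, F (a * b)%g = (F a + F b)%R.
  move=> a b; rewrite /F -natrD; apply: val_inj; rewrite /= !val_Fp_nat //.
  apply: fermat_quotientM => //; try by apply: block_det_unit; apply: subgP.
  by rewrite block_detM ?subgP.
rewrite /F subgK // Eg => /eqP; rewrite -(dvdn_pcharf (pchar_Fp p_pr)).
by apply/negP/fermat_quotient1p.
Qed.

End BlockDeterminant.

(* lambda_j is nth 0 lam (j - 1); the default value of nth gives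
   lambda_(k+1) = 0. *)
Theorem mainTheorem5 (p k : nat) (lam rho : k.-tuple nat)
    (hk : (0 < k)%N)
    (hlam_sorted : sorted gtn lam)
    (hlam_pos : forall j : 'I_k, (0 < tnth lam j)%N)
    (hrho_pos : forall j : 'I_k, (0 < tnth rho j)%N)
    (hp : prime p) (hp_odd : odd p) (hp3 : p <> 3%N) :
  forall i : nat, i \in [:: 1%N; 2%N] ->
    (cohomology (Aut [set: abelian_of p lam rho]) 'F_p i = 1%G
     <-> (forall j : nat, (j < k)%N ->
            (nth 0%N lam j - nth 0%N lam j.+1 <= 1)%N)).
Proof.
have p_gt3 : (3 < p)%N by case: p hp hp_odd hp3 => [|[|[|[|[|]]]]].
have gapless_acyclic : (forall j, (j < k)%N -> (nth 0%N lam j - nth 0%N lam j.+1 <= 1)%N) ->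
    low_acyclic p [Aut [set: abelian_of p lam rho]].
  move=> gaps; apply: (Aut_low_acyclic hp p_gt3); first exact: abelian_of_abelian.
  exact: gapless_abelian_of.
have H1_gapless : cohomology (Aut [set: abelian_of p lam rho]) 'F_p 1 = 1%G ->
    forall j, (j < k)%N -> (nth 0%N lam j - nth 0%N lam j.+1 <= 1)%N.
  move=> H1 j lt_jk; rewrite leqNgt; apply/negP=> gap_j.
  pose j0 := Ordinal lt_jk.
  have nth_anti (a b : nat) : (a < b)%N -> (b < k)%N -> (nth 0%N lam b < nth 0%N lam a)%N.
    move=> lt_ab lt_bk; apply: (sorted_ltn_nth (leT := gtn)) => //.
    - by move=> x y z /= lt_xy lt_zx; apply: ltn_trans lt_zx lt_xy.
    - by rewrite inE size_tuple (ltn_trans lt_ab).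
    by rewrite inE size_tuple.
  (* With threshold [nth 0 lam j], a smaller part is at most [nth 0 lam j.+1], hence at least 2
     below the threshold. *)
  have gap_lam (i : 'I_k) : (tnth lam i < nth 0%N lam j)%N -> ((tnth lam i).+2 <= nth 0%N lam j)%N.
    rewrite (tnth_nth 0%N) => lt_i.
    have [lt_ij | lt_ji | eq_ij] := ltngtP i j; last by rewrite eq_ij ltnn in lt_i.
      by have := nth_anti i j lt_ij lt_jk; rewrite ltnNge (ltnW lt_i).
    suffices : (nth 0%N lam i <= nth 0%N lam j.+1)%N by lia.
    move: lt_ji; rewrite leq_eqVlt => /orP[/eqP-> //|lt_ji].
    exact/ltnW/nth_anti.
  have high0 : high lam (nth 0%N lam j) (Tagged (fun i => 'I_(tnth rho i)) (Ordinal (hrho_pos j0))).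
    by rewrite /high /= (tnth_nth 0%N).
  have thr_gt1 : (1 < nth 0%N lam j)%N by lia.
  by have /eqP[] := block_det_hom hp hlam_pos thr_gt1 gap_lam high0.
move=> i; rewrite !inE => /orP[] /eqP ->; split.
- exact: H1_gapless.
- by move=> gaps; apply: low_acyclic_cohomology1 hp (gapless_acyclic gaps).
- by move=> H2; apply: H1_gapless; apply: cohomology2_cohomology1 hp H2.
by move=> gaps; apply: low_acyclic_cohomology2 (gapless_acyclic gaps).
Qed.
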